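(* Let $n\in\mathbb{N}$. For all $0\leq q<1$ the universal C*-algebra $C(S^{2n+1}_q)$ of $\mathcal{A}(S^{2n+1}_q)$ exists. If $q\neq 0$, the canonical *-homomorphism from $\mathcal{A}(S^{2n+1}_q)$ to its universal C*-algebra $C(S^{2n+1}_q)$ is injective.
   Context: $\mathbb{N}=\{0,1,2,\dots\}$. For $n\in\mathbb{N}$ and a real number $0\leq q<1$, $\mathcal{A}(S^{2n+1}_q)$ denotes the unital associative complex *-algebra generated by elements $\{z_i,z_i^*\}_{i=0}^n$ (with $z_i^*$ the adjoint of $z_i$) with relations (a) $z_jz_i=q\,z_iz_j$ for all $0\leq i<j\leq n$; (b) $z_i^*z_j=q\,z_jz_i^*$ for all $0\leq i\neq j\leq n$; (c) $z_i^*z_i=z_iz_i^*+(1-q^2)\sum_{j=i+1}^n z_jz_j^*$ for all $0\leq i\leq n$; (d) $z_0z_0^*+z_1z_1^*+\ldots+z_nz_n^*=1$. An empty sum is $0$. All algebras and homomorphisms are unital. A universal C*-algebra of a *-algebra $A$ is a pair $(B,\phi)$ with $B$ a C*-algebra and $\phi:A\to B$ a *-homomorphism (the canonical one) such that for every C*-algebra $C$ and every *-homomorphism $f:A\to C$ there exists a unique *-homomorphism $\widetilde f:B\to C$ with $\widetilde f\circ\phi=f$. *)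

(* Defs.v *)
From HB Require Import structures.
From mathcomp Require Import all_boot all_order all_algebra.
From mathcomp Require Import complex generic_quotient.
From mathcomp Require Import all_classical all_reals all_analysis.

Set Implicit Arguments.
Unset Strict Implicit.
Unset Printing Implicit Defensive.

Import Order.TTheory GRing.Theory Num.Theory.

Local Open Scope ring_scope.
Local Open Scope complex_scope.

HB.mixin Record isStarAlgebra (K : numClosedFieldType) A
    of GRing.Algebra K A := {
  star : A -> A;
  starD : forall x y : A, star (x + y) = star x + star y;
  starZ : forall (a : K) (x : A), star (a *: x) = Num.conj a *: star x;
  starM : forall x y : A, star (x * y) = star y * star x;
  starK : forall x : A, star (star x) = x
}.

(* As for [algType], 1 != 0 in a [starAlgType]: the zero algebra is excluded.  *)
#[short(type="starAlgType")]
HB.structure Definition StarAlgebra (K : numClosedFieldType) :=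
  {A of GRing.Algebra K A & isStarAlgebra K A}.

(* The norm is part of the mixin, since MathComp has no common extension of    *)
(* its ring and normed module hierarchies other than [numDomainType].          *)
HB.mixin Record isCStarAlgebra (R : realType) A of StarAlgebra R[i] A := {
  cnorm : A -> R;
  cnorm_eq0 : forall x : A, cnorm x = 0 -> x = 0;
  cnormD_le : forall x y : A, cnorm (x + y) <= cnorm x + cnorm y;
  cnormZ : forall (a : R[i]) (x : A), cnorm (a *: x) = Normc.normc a * cnorm x;
  cnormM_le : forall x y : A, cnorm (x * y) <= cnorm x * cnorm y;
  cnorm_star : forall x : A, cnorm (star x * x) = cnorm x ^+ 2;
  cnorm_complete : forall u : nat -> A,
    (forall e : R, 0 < e -> exists N : nat, forall j k : nat,
       (N <= j)%N -> (N <= k)%N -> cnorm (u j - u k) < e) ->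
    exists l : A, forall e : R, 0 < e -> exists N : nat, forall k : nat,
       (N <= k)%N -> cnorm (u k - l) < e
}.

#[short(type="cstarAlgType")]
HB.structure Definition CStarAlgebra (R : realType) :=
  {A of StarAlgebra R[i] A & isCStarAlgebra R A}.

Definition star_hom (K : numClosedFieldType) (A B : starAlgType K)
    (f : A -> B) : Prop :=
  [/\ forall x y, f (x + y) = f x + f y,
      forall (a : K) x, f (a *: x) = a *: f x,
      f 1 = 1,
      forall x y, f (x * y) = f x * f y &
      forall x, f (star x) = star (f x)].

(* Letting [C] be the zero algebra would not change the notion, as all maps to *)
(* the zero algebra are equal *-homomorphisms.                                 *)
Definition universal_cstar (R : realType) (A : starAlgType R[i])
    (B : cstarAlgType R) (phi : A -> B) : Prop :=
  star_hom phi /\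
  forall (C : cstarAlgType R) (f : A -> C), star_hom f ->
    exists! g : B -> C, star_hom g /\ forall a, g (phi a) = f a.

(* Presentations of *-algebras: formal *-algebra expressions in the generators *)
(* [I], modulo the least congruence containing the given relations and the     *)
(* axioms of unital *-algebras.                                                *)
Inductive star_expr (K I : Type) : Type :=
| Egen of I
| Ezero
| Eone
| Eadd of star_expr K I & star_expr K I
| Eopp of star_expr K I
| Emul of star_expr K I & star_expr K I
| Escale of K & star_expr K I
| Estar of star_expr K I.

Arguments Egen {K I}.
Arguments Ezero {K I}.
Arguments Eone {K I}.
Arguments Eadd {K I}.

Declare Scope star_expr_scope.
Delimit Scope star_expr_scope with E.
Bind Scope star_expr_scope with star_expr.
Notation "0" := Ezero : star_expr_scope.
Notation "1" := Eone : star_expr_scope.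
Notation "x + y" := (Eadd x y) : star_expr_scope.
Notation "- x" := (Eopp x) : star_expr_scope.
Notation "x * y" := (Emul x y) : star_expr_scope.
Notation "a *: x" := (Escale a%R x) : star_expr_scope.
Notation "x ^*" := (Estar x) : star_expr_scope.
Notation "\sum_ ( i < n | P ) F" := (\big[Eadd/Ezero]_(i < n | P%B) F%E) :
  star_expr_scope.
Notation "\sum_ ( i < n ) F" := (\big[Eadd/Ezero]_(i < n) F%E) :
  star_expr_scope.

HB.instance Definition _ (K I : Type) := gen_eqMixin (star_expr K I).
HB.instance Definition _ (K I : Type) := gen_choiceMixin (star_expr K I).

Section Presentation.
Context (K : numClosedFieldType) (I : Type).
Context (rel0 : star_expr K I -> star_expr K I -> Prop).

Inductive star_cong : star_expr K I -> star_expr K I -> Prop :=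
| cong_rel x y of rel0 x y : star_cong x y
| cong_refl x : star_cong x x
| cong_sym x y of star_cong x y : star_cong y x
| cong_trans y x z of star_cong x y & star_cong y z : star_cong x z
| cong_add x x' y y' of star_cong x x' & star_cong y y' :
    star_cong (x + y)%E (x' + y')%E
| cong_opp x x' of star_cong x x' : star_cong (- x)%E (- x')%E
| cong_mul x x' y y' of star_cong x x' & star_cong y y' :
    star_cong (x * y)%E (x' * y')%E
| cong_scale a x x' of star_cong x x' : star_cong (a *: x)%E (a *: x')%E
| cong_star x x' of star_cong x x' : star_cong (x^*)%E (x'^*)%E
| cong_addA x y z : star_cong (x + (y + z))%E (x + y + z)%E
| cong_addC x y : star_cong (x + y)%E (y + x)%E
| cong_add0 x : star_cong (0 + x)%E x
| cong_addN x : star_cong (- x + x)%E 0%E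
| cong_mulA x y z : star_cong (x * (y * z))%E (x * y * z)%E
| cong_mul1l x : star_cong (1 * x)%E x
| cong_mul1r x : star_cong (x * 1)%E x
| cong_mulDl x y z : star_cong ((x + y) * z)%E (x * z + y * z)%E
| cong_mulDr x y z : star_cong (x * (y + z))%E (x * y + x * z)%E
| cong_scaleA a b x : star_cong (a *: (b *: x))%E ((a * b) *: x)%E
| cong_scale1 x : star_cong (1 *: x)%E x
| cong_scaleDr a x y : star_cong (a *: (x + y))%E (a *: x + a *: y)%E
| cong_scaleDl a b x : star_cong ((a + b) *: x)%E (a *: x + b *: x)%E
| cong_scaleAl a x y : star_cong (a *: (x * y))%E (a *: x * y)%E
| cong_scaleAr a x y : star_cong (a *: (x * y))%E (x * (a *: y))%E
| cong_starD x y : star_cong ((x + y)^*)%E (x^* + y^*)%E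
| cong_starZ a x : star_cong ((a *: x)^*)%E (Num.conj a *: x^*)%E
| cong_starM x y : star_cong ((x * y)^*)%E (y^* * x^*)%E
| cong_starK x : star_cong (x^*^*)%E x.

Definition star_congb (x y : star_expr K I) : bool := `[< star_cong x y >].

Lemma star_congb_refl : reflexive star_congb.
Proof. by move=> x; apply/asboolP/cong_refl. Qed.

Lemma star_congb_sym : symmetric star_congb.
Proof. by move=> x y; apply/asboolP/asboolP => h; apply: cong_sym. Qed.

Lemma star_congb_trans : transitive star_congb.
Proof.
by move=> y x z /asboolP h /asboolP k; apply/asboolP/(cong_trans h k).
Qed.

Canonical star_congb_equiv :=
  EquivRel star_congb star_congb_refl star_congb_sym star_congb_trans.

Definition star_presentation : Type := {eq_quot star_congb}%qT.

HB.instance Definition _ := Choice.on star_presentation.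

Definition pr_class (x : star_expr K I) : star_presentation :=
  (\pi_({eq_quot star_congb}%qT) x)%qT.
Definition pr_repr (x : star_presentation) : star_expr K I :=
  repr (x : {eq_quot star_congb}%qT).

Lemma pr_reprK : cancel pr_repr pr_class.
Proof. by move=> x; exact: reprK. Qed.

Lemma pr_classP x y : pr_class x = pr_class y <-> star_cong x y.
Proof.
split=> [/eqquotP/asboolP //|h].
by apply/eqquotP/asboolP.
Qed.

Lemma pr_classK x : star_cong (pr_repr (pr_class x)) x.
Proof. by apply/pr_classP; rewrite pr_reprK. Qed.

Definition pr_gen (i : I) : star_presentation := pr_class (Egen i).
Definition pr_zero : star_presentation := pr_class 0%E.
Definition pr_one : star_presentation := pr_class 1%E.
Definition pr_add (x y : star_presentation) : star_presentation :=
  pr_class (pr_repr x + pr_repr y)%E.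
Definition pr_opp (x : star_presentation) : star_presentation :=
  pr_class (- pr_repr x)%E.
Definition pr_mul (x y : star_presentation) : star_presentation :=
  pr_class (pr_repr x * pr_repr y)%E.
Definition pr_scale (a : K) (x : star_presentation) : star_presentation :=
  pr_class (a *: pr_repr x)%E.
Definition pr_star (x : star_presentation) : star_presentation :=
  pr_class ((pr_repr x)^*)%E.

Lemma pr_addE x y : pr_add (pr_class x) (pr_class y) = pr_class (x + y)%E.
Proof. by apply/pr_classP; apply: cong_add; apply: pr_classK. Qed.
Lemma pr_oppE x : pr_opp (pr_class x) = pr_class (- x)%E.
Proof. by apply/pr_classP; apply: cong_opp; apply: pr_classK. Qed.
Lemma pr_mulE x y : pr_mul (pr_class x) (pr_class y) = pr_class (x * y)%E.
Proof. by apply/pr_classP; apply: cong_mul; apply: pr_classK. Qed.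
Lemma pr_scaleE a x : pr_scale a (pr_class x) = pr_class (a *: x)%E.
Proof. by apply/pr_classP; apply: cong_scale; apply: pr_classK. Qed.
Lemma pr_starE x : pr_star (pr_class x) = pr_class (x^*)%E.
Proof. by apply/pr_classP; apply: cong_star; apply: pr_classK. Qed.

Let prE := (pr_addE, pr_oppE, pr_mulE, pr_scaleE, pr_starE).

Lemma pr_ind (P : star_presentation -> Prop) :
  (forall x, P (pr_class x)) -> forall x, P x.
Proof. by move=> h x; rewrite -(pr_reprK x). Qed.

Lemma pr_addA : associative pr_add.
Proof.
elim/pr_ind=> x; elim/pr_ind=> y; elim/pr_ind=> z.
by rewrite !prE; apply/pr_classP/cong_addA.
Qed.
Lemma pr_addC : commutative pr_add.
Proof.
by elim/pr_ind=> x; elim/pr_ind=> y; rewrite !prE; apply/pr_classP/cong_addC.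
Qed.
Lemma pr_add0 : left_id pr_zero pr_add.
Proof. by elim/pr_ind=> x; rewrite prE; apply/pr_classP/cong_add0. Qed.
Lemma pr_addN : left_inverse pr_zero pr_opp pr_add.
Proof. by elim/pr_ind=> x; rewrite !prE; apply/pr_classP/cong_addN. Qed.

HB.instance Definition _ :=
  GRing.isZmodule.Build star_presentation pr_addA pr_addC pr_add0 pr_addN.

Lemma pr_mulA : associative pr_mul.
Proof.
elim/pr_ind=> x; elim/pr_ind=> y; elim/pr_ind=> z.
by rewrite !prE; apply/pr_classP/cong_mulA.
Qed.
Lemma pr_mul1l : left_id pr_one pr_mul.
Proof. by elim/pr_ind=> x; rewrite prE; apply/pr_classP/cong_mul1l. Qed.
Lemma pr_mul1r : right_id pr_one pr_mul.
Proof. by elim/pr_ind=> x; rewrite prE; apply/pr_classP/cong_mul1r. Qed.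
Lemma pr_mulDl : left_distributive pr_mul pr_add.
Proof.
elim/pr_ind=> x; elim/pr_ind=> y; elim/pr_ind=> z.
by rewrite !prE; apply/pr_classP/cong_mulDl.
Qed.
Lemma pr_mulDr : right_distributive pr_mul pr_add.
Proof.
elim/pr_ind=> x; elim/pr_ind=> y; elim/pr_ind=> z.
by rewrite !prE; apply/pr_classP/cong_mulDr.
Qed.

HB.instance Definition _ := GRing.Zmodule_isPzRing.Build star_presentation
  pr_mulA pr_mul1l pr_mul1r pr_mulDl pr_mulDr.

Lemma pr_scaleA a b x : pr_scale a (pr_scale b x) = pr_scale (a * b) x.
Proof.
by elim/pr_ind: x => x; rewrite !prE; apply/pr_classP/cong_scaleA.
Qed.
Lemma pr_scale1 : left_id 1 pr_scale.
Proof. by elim/pr_ind=> x; rewrite prE; apply/pr_classP/cong_scale1. Qed.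
Lemma pr_scaleDr : right_distributive pr_scale +%R.
Proof.
move=> a; elim/pr_ind=> x; elim/pr_ind=> y.
by rewrite /GRing.add /= !prE; apply/pr_classP/cong_scaleDr.
Qed.
Lemma pr_scaleDl x : {morph pr_scale^~ x : a b / a + b}.
Proof.
move=> a b; elim/pr_ind: x => x.
by rewrite [RHS]/GRing.add /= !prE; apply/pr_classP/cong_scaleDl.
Qed.

HB.instance Definition _ := GRing.Zmodule_isLmodule.Build K star_presentation
  pr_scaleA pr_scale1 pr_scaleDr pr_scaleDl.

Lemma pr_scaleAl (a : K) (x y : star_presentation) :
  a *: (x * y) = (a *: x) * y.
Proof.
elim/pr_ind: x => x; elim/pr_ind: y => y.
by rewrite /GRing.scale /GRing.mul /= !prE; apply/pr_classP/cong_scaleAl.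
Qed.
Lemma pr_scaleAr (a : K) (x y : star_presentation) :
  a *: (x * y) = x * (a *: y).
Proof.
elim/pr_ind: x => x; elim/pr_ind: y => y.
by rewrite /GRing.scale /GRing.mul /= !prE; apply/pr_classP/cong_scaleAr.
Qed.
Lemma pr_starD (x y : star_presentation) :
  pr_star (x + y) = pr_star x + pr_star y.
Proof.
elim/pr_ind: x => x; elim/pr_ind: y => y.
by rewrite /GRing.add /= !prE; apply/pr_classP/cong_starD.
Qed.
Lemma pr_starZ (a : K) (x : star_presentation) :
  pr_star (a *: x) = Num.conj a *: pr_star x.
Proof.
elim/pr_ind: x => x.
by rewrite /GRing.scale /= !prE; apply/pr_classP/cong_starZ.
Qed.
Lemma pr_starM (x y : star_presentation) :
  pr_star (x * y) = pr_star y * pr_star x.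
Proof.
elim/pr_ind: x => x; elim/pr_ind: y => y.
by rewrite /GRing.mul /= !prE; apply/pr_classP/cong_starM.
Qed.
Lemma pr_starK (x : star_presentation) : pr_star (pr_star x) = x.
Proof. by elim/pr_ind: x => x; rewrite !prE; apply/pr_classP/cong_starK. Qed.

Fixpoint star_eval (B : starAlgType K) (b : I -> B) (x : star_expr K I) : B :=
  match x with
  | Egen i => b i
  | Ezero => 0
  | Eone => 1
  | Eadd x y => star_eval b x + star_eval b y
  | Eopp x => - star_eval b x
  | Emul x y => star_eval b x * star_eval b y
  | Escale a x => a *: star_eval b x
  | Estar x => star (star_eval b x)
  end.

Lemma star_eval_cong (B : starAlgType K) (b : I -> B) :
  (forall x y, rel0 x y -> star_eval b x = star_eval b y) ->
  forall x y, star_cong x y -> star_eval b x = star_eval b y.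
Proof.
move=> hb x y; elim=> //=.
- by move=> {}y {}x z _ -> _ ->.
- by move=> ? ? ? ? _ -> _ ->.
- by move=> ? ? _ ->.
- by move=> ? ? ? ? _ -> _ ->.
- by move=> ? ? ? _ ->.
- by move=> ? ? _ ->.
- by move=> *; rewrite addrA.
- by move=> *; rewrite addrC.
- by move=> *; rewrite add0r.
- by move=> *; rewrite addNr.
- by move=> *; rewrite mulrA.
- by move=> *; rewrite mul1r.
- by move=> *; rewrite mulr1.
- by move=> *; rewrite mulrDl.
- by move=> *; rewrite mulrDr.
- by move=> *; rewrite scalerA.
- by move=> *; rewrite scale1r.
- by move=> *; rewrite scalerDr.
- by move=> *; rewrite scalerDl.
- by move=> *; rewrite scalerAl.
- by move=> *; rewrite scalerAr.
- by move=> *; rewrite starD.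
- by move=> *; rewrite starZ.
- by move=> *; rewrite starM.
- by move=> *; rewrite starK.
Qed.

Lemma pr_one_neq0 (B : starAlgType K) (b : I -> B) :
  (forall x y, rel0 x y -> star_eval b x = star_eval b y) ->
  (1 : star_presentation) != 0.
Proof.
move=> hb; apply/eqP => /pr_classP/(star_eval_cong hb)/= /eqP.
by rewrite oner_eq0.
Qed.

End Presentation.

Section RegularStar.
Variable K : numClosedFieldType.

Let conjD (x y : K^o) :
  Num.conj (x + y : K) = (Num.conj (x : K) + Num.conj (y : K) : K^o).
Proof. exact: rmorphD. Qed.
Let conjZ (a : K) (x : K^o) :
  Num.conj (a *: x : K) = (Num.conj a *: (Num.conj (x : K) : K^o) : K^o).
Proof. exact: rmorphM. Qed.
Let conjM (x y : K^o) :
  Num.conj (x * y : K) = (Num.conj (y : K) * Num.conj (x : K) : K^o).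
Proof. by rewrite rmorphM mulrC. Qed.
Let conjK' (x : K^o) : Num.conj (Num.conj (x : K)) = x.
Proof. exact: conjCK. Qed.

HB.instance Definition _ :=
  isStarAlgebra.Build K K^o conjD conjZ conjM conjK'.

End RegularStar.

Local Notation Z := Egen.

Inductive qsphere_rel (R : realType) (n : nat) (q : R) :
    star_expr R[i] 'I_n.+1 -> star_expr R[i] 'I_n.+1 -> Prop :=
| qsphere_zz (i j : 'I_n.+1) of (i < j)%N :
    qsphere_rel q (Z j * Z i)%E (q%:C *: (Z i * Z j))%E
| qsphere_sz (i j : 'I_n.+1) of i != j :
    qsphere_rel q ((Z i)^* * Z j)%E (q%:C *: (Z j * (Z i)^*))%E
| qsphere_ss (i : 'I_n.+1) :
    qsphere_rel q ((Z i)^* * Z i)%E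
      (Z i * (Z i)^* +
       (1 - q ^+ 2)%:C *: \sum_(j < n.+1 | (i < j)%N) (Z j * (Z j)^*))%E
| qsphere_sum :
    qsphere_rel q (\sum_(i < n.+1) (Z i * (Z i)^*))%E 1%E.

Lemma qsphere_relP (R : realType) (n : nat) (q : R)
    (B : starAlgType R[i]) (z : 'I_n.+1 -> B) :
  (forall x y, qsphere_rel q x y -> star_eval z x = star_eval z y) <->
  [/\ forall i j : 'I_n.+1, (i < j)%N -> z j * z i = q%:C *: (z i * z j),
      forall i j, i != j -> star (z i) * z j = q%:C *: (z j * star (z i)),
      forall i, star (z i) * z i = z i * star (z i) +
        (1 - q ^+ 2)%:C *: \sum_(j < n.+1 | (i < j)%N) z j * star (z j) &
      \sum_(i < n.+1) z i * star (z i) = 1].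
Proof.
have evS (P : pred 'I_n.+1) (F : 'I_n.+1 -> star_expr R[i] 'I_n.+1) :
    star_eval z (\big[Eadd/Ezero]_(j < n.+1 | P j) F j) =
    \sum_(j < n.+1 | P j) star_eval z (F j).
  exact: (big_morph (star_eval z) (id1 := 0) (op1 := +%R)).
split=> [h|[ha hb hc hd] x y []].
- split=> [i j ij|i j ij|i|].
  + exact: (h _ _ (qsphere_zz q ij)).
  + exact: (h _ _ (qsphere_sz q ij)).
  + by have /= := h _ _ (qsphere_ss q i); rewrite evS.
  + by have /= := h _ _ (qsphere_sum n q); rewrite evS.
- exact: ha.
- exact: hb.
- by move=> i /=; rewrite evS; exact: hc.
- by rewrite evS; exact: hd.
Qed.

Definition qsphere (R : realType) (n : nat) (q : R) : Type :=
  star_presentation (@qsphere_rel R n q).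

Section QSphere.
Variables (R : realType) (n : nat) (q : R).
Local Notation A := (qsphere n q).
Local Notation pr := (star_presentation (@qsphere_rel R n q)).

HB.instance Definition _ := GRing.PzRing.copy A pr.
HB.instance Definition _ := GRing.Lmodule.copy A pr.

Lemma qsphere_one_neq0 : (1 : A) != 0.
Proof.
apply: (@pr_one_neq0 _ _ _ R[i]^o (fun i => (i == ord0)%:R)).
apply/qsphere_relP; split => [i j ij|i j ij|i|].
- have /negPf-> : j != ord0 by rewrite -lt0n; exact: leq_ltn_trans ij.
  by rewrite mul0r mulr0 scaler0.
- case: (eqVneq j ord0) ij => [->|_ _]; last by rewrite mulr0 mul0r scaler0.
  by move=> /negPf->; rewrite /star /= conjC0 mul0r mulr0 scaler0.
- rewrite big1 ?scaler0 ?addr0 1?mulrC // => j ij.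
  have /negPf-> : j != ord0 by rewrite -lt0n; exact: leq_ltn_trans ij.
  by rewrite mul0r.
- rewrite (bigD1 ord0) //= big1 ?addr0 => [|j /negPf->]; last by rewrite mul0r.
  by rewrite [LHS]mul1r /star /= conjC1.
Qed.

HB.instance Definition _ :=
  GRing.PzSemiRing_isNonZero.Build A qsphere_one_neq0.
HB.instance Definition _ :=
  GRing.LSemiModule_isLSemiAlgebra.Build R[i] A (@pr_scaleAl _ _ _).
HB.instance Definition _ :=
  GRing.LSemiAlgebra_isSemiAlgebra.Build R[i] A (@pr_scaleAr _ _ _).
HB.instance Definition _ := isStarAlgebra.Build R[i] A
  (@pr_starD _ _ _) (@pr_starZ _ _ _) (@pr_starM _ _ _) (@pr_starK _ _ _).

Definition qsphere_z (i : 'I_n.+1) : A := pr_gen _ i.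

Lemma star_eval_qsphere x : star_eval qsphere_z x = pr_class _ x.
Proof.
elim: x => //= [x -> y ->|x ->|x -> y ->|a x ->|x ->].
- exact: pr_addE.
- exact: pr_oppE.
- exact: pr_mulE.
- exact: pr_scaleE.
- exact: pr_starE.
Qed.

Lemma qsphere_zP :
  [/\ forall i j : 'I_n.+1, (i < j)%N ->
        qsphere_z j * qsphere_z i = q%:C *: (qsphere_z i * qsphere_z j),
      forall i j, i != j ->
        star (qsphere_z i) * qsphere_z j =
        q%:C *: (qsphere_z j * star (qsphere_z i)),
      forall i, star (qsphere_z i) * qsphere_z i =
        qsphere_z i * star (qsphere_z i) +
        (1 - q ^+ 2)%:C *:
          \sum_(j < n.+1 | (i < j)%N) qsphere_z j * star (qsphere_z j) &
      \sum_(i < n.+1) qsphere_z i * star (qsphere_z i) = 1].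
Proof.
apply/(qsphere_relP q qsphere_z) => x y h.
by rewrite !star_eval_qsphere; apply/pr_classP/cong_rel.
Qed.

Lemma qsphere_univ (B : starAlgType R[i]) (z : 'I_n.+1 -> B) :
  [/\ forall i j : 'I_n.+1, (i < j)%N -> z j * z i = q%:C *: (z i * z j),
      forall i j, i != j -> star (z i) * z j = q%:C *: (z j * star (z i)),
      forall i, star (z i) * z i = z i * star (z i) +
        (1 - q ^+ 2)%:C *: \sum_(j < n.+1 | (i < j)%N) z j * star (z j) &
      \sum_(i < n.+1) z i * star (z i) = 1] ->
  exists! f : A -> B, star_hom f /\ forall i, f (qsphere_z i) = z i.
Proof.
move=> /qsphere_relP hz; pose f (x : A) := star_eval z (pr_repr x).
have fE x : f (pr_class _ x) = star_eval z x.
  by apply: star_eval_cong hz _ _ _; apply: pr_classK.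
exists f; split.
  split; last by move=> i; exact: (fE (Egen i)).
  split.
  - elim/pr_ind=> x; elim/pr_ind=> y.
    rewrite (fE x) (fE y); exact: (etrans (congr1 f (pr_addE _ x y)) (fE (x + y)%E)).
  - move=> a; elim/pr_ind=> x.
    rewrite (fE x); exact: (etrans (congr1 f (pr_scaleE _ a x)) (fE (a *: x)%E)).
  - exact: fE.
  - elim/pr_ind=> x; elim/pr_ind=> y.
    rewrite (fE x) (fE y); exact: (etrans (congr1 f (pr_mulE _ x y)) (fE (x * y)%E)).
  - elim/pr_ind=> x.
    rewrite (fE x); exact: (etrans (congr1 f (pr_starE _ x)) (fE (x^*)%E)).
move=> g [[gD gZ g1 gM gS] gz]; apply/funext; elim/pr_ind=> x.
have g0 : g 0 = 0 by rewrite -(scale0r (0 : A)) gZ scale0r.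
have gN y : g (- y) = - g y by rewrite -scaleN1r gZ scaleN1r.
rewrite fE -star_eval_qsphere.
elim: x => //= [x -> y ->|x ->|x -> y ->|a x ->|x ->].
- by rewrite gD.
- by rewrite gN.
- by rewrite gM.
- by rewrite gZ.
- by rewrite gS.
Qed.

End QSphere.

(* Main.v *)
Require Import Defs.
From HB Require Import structures.
From mathcomp Require Import all_boot all_order all_algebra.
From mathcomp Require Import complex generic_quotient ring lra finmap.
From mathcomp Require Import all_classical all_reals all_analysis.

Set Implicit Arguments.
Unset Strict Implicit.
Unset Printing Implicit Defensive.

Import Order.TTheory GRing.Theory Num.Theory.
Import numFieldNormedType.Exports.

Local Open Scope classical_set_scope.
Local Open Scope ring_scope.
Local Open Scope complex_scope.

(** Existence. A universal C*-algebra of a unital *-algebra A is the completion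
    of A for the largest C*-seminorm on A, provided that the C*-seminorms of
    every a in A are bounded and that one of them is not zero. For the sphere a
    bound follows from the relations by elementary means: with
    x_k = sum_(j >= k) z_j z_j^* they say z_i z_i^* = x_i - x_(i+1) and
    z_i^* z_i = x_i - q^2 x_(i+1) = (1 - q^2) x_i + q^2 z_i z_i^*. As z_i^* z_i
    and z_i z_i^* have the same seminorm p(z_i)^2, one gets p(z_i)^2 <= p(x_i),
    hence p(x_(i+1)) <= 2 p(x_i), starting from x_0 = 1
    ([csn_z_le_tail], [csn_tail_le]). The character z_0 |-> 1, z_i |-> 0 gives a
    nonzero seminorm. The extension of a *-homomorphism to the completion is
    unique because *-homomorphisms between C*-algebras are contractive
    ([star_hom_contractive]), which holds because a self-adjoint h of norm < 1 is
    the real part of the unitary h + i sqrt(1 - h^2) ([cstar_unitary_dilation]).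

    Injectivity. The canonical map is injective as soon as A has a C*-seminorm
    vanishing only at 0, since A then embeds into a C*-algebra, namely its
    completion. Such a seminorm is the operator norm of a faithful
    *-representation on a space with inner product. For 0 < q < 1 it acts on
    finitely supported functions on the cone N^n x Z by weighted shifts: z_i moves
    the i-th coordinate up, with weight sqrt(tau_i - tau_(i+1)), where
    tau_k(y) = q^(2 (y_0 + ... + y_(k-1))) is the eigenvalue of x_k and
    tau_(n+1) = 0 ([zop_relations]).

    Faithfulness. As q <> 0, the generators and their adjoints commute with each
    other up to nonzero scalars, except z_i with z_i^*, whose products are
    combinations of x_i and x_(i+1). So A is spanned by the monomials
    x_1^m_1 ... x_n^m_n z_0^(d_0) ... z_n^(d_n) with m_k in N and d_i in Z, a
    negative exponent standing for a power of z_i^* ([mono_span]). Such a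
    monomial acts as the shift by d with the weight chi_m(y) g_d(y), where
    chi_m = tau_1^m_1 ... tau_n^m_n is a character of Z^(n+1) and g_d does not
    vanish at points with large coordinates. Distinct m give distinct
    characters, so Dedekind's independence of characters shows that the
    monomials act linearly independently ([mono_independent]). *)

(** * C*-seminorms and their limits *)

Lemma normc_real (R : realType) (x : R) : Normc.normc x%:C = `|x|.
Proof. by rewrite /Normc.normc /= expr0n /= addr0; exact: sqrtr_sqr. Qed.

Lemma normc_ge0 (R : realType) (c : R[i]) : 0 <= Normc.normc c.
Proof. by case: c => a b; exact: sqrtr_ge0. Qed.

Lemma realC_eq0 (R : realType) (x : R) : (x%:C == 0 :> R[i]) = (x == 0).
Proof. by rewrite -(rmorph0 (real_complex R)) (inj_eq (@complexI R)). Qed.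

Section StarTheory.
Variables (K : numClosedFieldType) (A : starAlgType K).

Lemma star0 : star (0 : A) = 0.
Proof. by rewrite -[in LHS](scale0r (0 : A)) starZ rmorph0 scale0r. Qed.

Lemma star1 : star (1 : A) = 1.
Proof. by rewrite -[LHS]mulr1 -[X in _ * X]starK -starM mulr1 starK. Qed.

Lemma starN (x : A) : star (- x) = - star x.
Proof. by apply/eqP; rewrite -addr_eq0 -starD addNr star0. Qed.

Lemma starB (x y : A) : star (x - y) = star x - star y.
Proof. by rewrite starD starN. Qed.

Lemma star_sum (I : Type) (r : seq I) (P : pred I) (F : I -> A) :
  star (\sum_(i <- r | P i) F i) = \sum_(i <- r | P i) star (F i).
Proof. exact: (big_morph (@star K A) starD star0). Qed.

End StarTheory.

(** The last axiom only excludes the zero seminorm: it forces the value 1 at 1,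
    and makes the completion a nonzero algebra. *)
Record cstar_seminorm (R : realType) (A : starAlgType R[i]) := CStarSeminorm {
  csn :> A -> R;
  csn_leD : forall x y, csn (x + y) <= csn x + csn y;
  csnZ : forall a x, csn (a *: x) = Normc.normc a * csn x;
  csn_leM : forall x y, csn (x * y) <= csn x * csn y;
  csn_star_mul : forall x, csn (star x * x) = csn x ^+ 2;
  csn1_neq0 : csn 1 != 0
}.

Section SeminormTheory.
Variables (R : realType) (A : starAlgType R[i]) (p : cstar_seminorm A).
Implicit Types x y : A.

Lemma csn0 : p 0 = 0.
Proof. by rewrite -[in LHS](scale0r 0) csnZ Normc.normc0 mul0r. Qed.

Lemma csnN x : p (- x) = p x.
Proof. by rewrite -scaleN1r csnZ normcN Normc.normc1 mul1r. Qed.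

Lemma csnC x y : p (x - y) = p (y - x).
Proof. by rewrite -csnN opprB. Qed.

Lemma csn_ge0 x : 0 <= p x.
Proof. by have := csn_leD p x (- x); rewrite subrr csn0 csnN; lra. Qed.

Lemma csn_leB x y : p (x - y) <= p x + p y.
Proof. by rewrite -(csnN y); exact: csn_leD. Qed.

Lemma csn_tri x y z : p (x - z) <= p (x - y) + p (y - z).
Proof. by apply: le_trans (csn_leD _ _ _); rewrite addrA subrK. Qed.

Lemma csn_dist x y : `|p x - p y| <= p (x - y).
Proof.
have h u v : p u <= p (u - v) + p v.
  by apply: le_trans (csn_leD _ _ _); rewrite subrK.
rewrite ler_norml; apply/andP; split; last by rewrite lerBlDr.
by rewrite lerNl opprB lerBlDr csnC.
Qed.

Lemma csn_star x : p (star x) = p x.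
Proof.
have h y : p y <= p (star y).
  have [->|y0] := eqVneq (p y) 0; first exact: csn_ge0.
  have y_gt0 : 0 < p y by rewrite lt_neqAle eq_sym y0 csn_ge0.
  by rewrite -(ler_pM2r y_gt0) -expr2 -csn_star_mul; exact: csn_leM.
by apply/eqP; rewrite eq_le (h x) andbT -[X in _ <= p X]starK h.
Qed.

Lemma csn_mul_star x : p (x * star x) = p x ^+ 2.
Proof. by rewrite -{1}[x]starK csn_star_mul csn_star. Qed.

Lemma csn1 : p 1 = 1.
Proof.
by apply: (mulfI (csn1_neq0 p)); rewrite mulr1 -expr2 -csn_star_mul star1 mulr1.
Qed.

End SeminormTheory.

Section SeminormLimits.
Variables (R : realType) (A : starAlgType R[i]) (p : cstar_seminorm A).
Implicit Types (u v : nat -> A) (e : nat -> R).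

Definition null_seq (e : nat -> R) : Prop := e @ \oo --> (0 : R).

Lemma null_seqD e e' : null_seq e -> null_seq e' -> null_seq (fun k => e k + e' k).
Proof. by move=> h h'; rewrite /null_seq -[0 : R]addr0; exact: cvgD. Qed.

Lemma null_seqM (c : R) e : null_seq e -> null_seq (fun k => c * e k).
Proof. by move=> h; rewrite /null_seq -(mulr0 c); exact: cvgMl_tmp. Qed.

Lemma null_seq_le e e' : (forall k, 0 <= e' k <= e k) -> null_seq e -> null_seq e'.
Proof.
move=> h he; apply: (@squeeze_cvgr _ _ _ _ (cst 0) e) => //.
- by near=> k; exact: h.
- exact: cvg_cst.
Unshelve. all: by end_near. Qed.

Lemma null_seq_harmonic : null_seq (@harmonic R).
Proof. exact: cvg_harmonic. Qed.

Lemma seq_lim_uniq (a : nat -> R) (l l' : R) :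
  a @ \oo --> l -> a @ \oo --> l' -> l = l'.
Proof. by move=> h h'; apply: (cvg_unique _ h h'); exact: norm_hausdorff. Qed.

Lemma null_seq_cvg (a b : nat -> R) (l : R) :
  null_seq (fun k => a k - b k) -> b @ \oo --> l -> a @ \oo --> l.
Proof.
move=> h hb; rewrite (_ : a = (fun k => a k - b k) + b); last first.
  by apply/funext => k; rewrite /GRing.add /= subrK.
by rewrite -[l]add0r; exact: cvgD h hb.
Qed.

Lemma null_seqP e : (forall k, 0 <= e k) ->
  null_seq e <-> forall d : R, 0 < d -> exists N, forall k, (N <= k)%N -> e k < d.
Proof.
move=> e0; split.
  move=> /cvgrPdist_lt h d d0; have [N _ hN] := h d d0.
  by exists N => k /hN; rewrite /= sub0r normrN ger0_norm.
move=> h; apply/cvgrPdist_lt => d d0; have [N hN] := h d d0.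
by exists N => // k /hN; rewrite /= sub0r normrN ger0_norm.
Qed.

(** Convergence for the seminorm p; limits are unique up to p-distance 0 only. *)
Definition slim u (l : A) : Prop := null_seq (fun k => p (u k - l)).

(** The Cauchy condition with an explicit null sequence of moduli, which behaves
    better under sums and products than the usual one with epsilons. *)
Definition cauchy_seq u : Prop :=
  exists2 e : nat -> R, null_seq e &
    forall N j k, (N <= j)%N -> (N <= k)%N -> p (u j - u k) <= e N.

Lemma slimD u v a b : slim u a -> slim v b -> slim (fun k => u k + v k) (a + b).
Proof.
move=> hu hv; apply: null_seq_le (null_seqD hu hv) => k.
by rewrite csn_ge0 opprD addrACA csn_leD.
Qed.

Lemma slimZ c u a : slim u a -> slim (fun k => c *: u k) (c *: a).
Proof.
move=> hu; apply: null_seq_le (null_seqM (Normc.normc c) hu) => k.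
by rewrite csn_ge0 -scalerBr csnZ lexx.
Qed.

Lemma slim_star u a : slim u a -> slim (fun k => star (u k)) (star a).
Proof.
by move=> hu; apply: null_seq_le hu => k; rewrite csn_ge0 -starB csn_star lexx.
Qed.

Lemma slim_cst a : slim (fun=> a) a.
Proof. by rewrite /slim subrr csn0; exact: cvg_cst. Qed.

Lemma slimM u v a b : slim u a -> slim v b -> slim (fun k => u k * v k) (a * b).
Proof.
move=> hu hv.
have hM : null_seq (fun k => p (u k - a) * p (v k - b)).
  by rewrite /null_seq -(mulr0 (0:R)); exact: cvgM hu hv.
apply: null_seq_le (null_seqD hM (null_seqD (null_seqM (p a) hv)
  (null_seqM (p b) hu))) => k.
rewrite csn_ge0 /=.
have -> : u k * v k - a * b =
    (u k - a) * (v k - b) + (a * (v k - b) + (u k - a) * b).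
  rewrite -{1}(subrK a (u k)) -{1}(subrK b (v k)) mulrDl !mulrDr.
  by rewrite addrA addrK -addrA [_ * b + _]addrC.
apply: le_trans (csn_leD _ _ _) _; apply: lerD; first exact: csn_leM.
apply: le_trans (csn_leD _ _ _) _; apply: lerD; first exact: csn_leM.
by rewrite mulrC; exact: csn_leM.
Qed.

Lemma slim_uniq u a b : slim u a -> slim u b -> p (a - b) = 0.
Proof.
move=> ha hb; have h : null_seq (fun=> p (a - b)).
  apply: null_seq_le (null_seqD ha hb) => k.
  by rewrite csn_ge0 [p (u k - a)]csnC csn_tri.
exact: seq_lim_uniq (cvg_cst _) h.
Qed.

Lemma slim_cauchy u a : slim u a -> forall d : R, 0 < d -> exists N, forall j k,
  (N <= j)%N -> (N <= k)%N -> p (u j - u k) < d.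
Proof.
move=> hu d d0; have d2 : 0 < d / 2 by lra.
have [N hN] := (null_seqP (fun k => csn_ge0 p (u k - a))).1 hu _ d2.
exists N => j k /hN hj /hN hk; apply: le_lt_trans (csn_tri _ _ a _) _.
by rewrite [p (a - _)]csnC; lra.
Qed.

Lemma cauchy_seqD u v : cauchy_seq u -> cauchy_seq v ->
  cauchy_seq (fun k => u k + v k).
Proof.
move=> [e he hu] [e' he' hv]; exists (fun k => e k + e' k); first exact: null_seqD.
move=> N j k Nj Nk; rewrite opprD addrACA; apply: le_trans (csn_leD _ _ _) _.
by apply: lerD; [exact: hu|exact: hv].
Qed.

Lemma cauchy_seqZ c u : cauchy_seq u -> cauchy_seq (fun k => c *: u k).
Proof.
move=> [e he hu]; exists (fun k => Normc.normc c * e k); first exact: null_seqM.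
move=> N j k Nj Nk; rewrite -scalerBr csnZ.
by rewrite ler_wpM2l ?normc_ge0 ?hu.
Qed.

Lemma cauchy_seq_star u : cauchy_seq u -> cauchy_seq (fun k => star (u k)).
Proof.
by move=> [e he hu]; exists e => // N j k Nj Nk; rewrite -starB csn_star hu.
Qed.

Lemma cauchy_seq_cst a : cauchy_seq (fun=> a).
Proof. by exists (fun=> 0); [exact: cvg_cst|move=> *; rewrite subrr csn0]. Qed.

Lemma cauchy_seq_bounded u : cauchy_seq u -> exists M : R, forall k, p (u k) <= M.
Proof.
move=> [e he hu]; exists (e 0%N + p (u 0%N)) => k.
rewrite -{1}[u k](subrK (u 0%N)); apply: le_trans (csn_leD _ _ _) _.
by rewrite lerD2r hu.
Qed.

Lemma cauchy_seqM u v : cauchy_seq u -> cauchy_seq v ->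
  cauchy_seq (fun k => u k * v k).
Proof.
move=> cu cv; have [M hM] := cauchy_seq_bounded cu.
have [M' hM'] := cauchy_seq_bounded cv.
case: cu cv => [e he hu] [e' he' hv].
exists (fun k => M * e' k + M' * e k); first by apply: null_seqD; exact: null_seqM.
move=> N j k Nj Nk.
have -> : u j * v j - u k * v k = u j * (v j - v k) + (u j - u k) * v k.
  by rewrite mulrBr mulrBl addrA subrK.
apply: le_trans (csn_leD _ _ _) _; apply: lerD.
  apply: le_trans (csn_leM _ _ _) _.
  by apply: ler_pM; rewrite ?csn_ge0 ?hM ?hv.
apply: le_trans (csn_leM _ _ _) _; rewrite mulrC.
by apply: ler_pM; rewrite ?csn_ge0 ?hM' ?hu.
Qed.

Lemma cauchy_seq_cvg u : cauchy_seq u -> cvg ((p \o u) @ \oo).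
Proof.
move=> [e he hu]; apply: cauchy_cvg; apply: cauchy_exP => d d0.
have e0 k : 0 <= e k by apply: le_trans (hu k k k _ _); rewrite ?csn_ge0.
have [N hN] := (null_seqP e0).1 he d d0.
exists (p (u N)); exists N => // k /= Nk; rewrite /ball /=.
apply: le_lt_trans (csn_dist _ _ _) _; apply: le_lt_trans (hN N _) => //.
exact: hu.
Qed.

End SeminormLimits.

(** * Completion of a *-algebra for a C*-seminorm *)

Section CauchySequences.
Variables (R : realType) (A : starAlgType R[i]) (p : cstar_seminorm A).

Definition cauchy_sequence : Type := {u : nat -> A | cauchy_seq p u}.

HB.instance Definition _ := gen_eqMixin cauchy_sequence.
HB.instance Definition _ := gen_choiceMixin cauchy_sequence.

Definition null_distb (u v : cauchy_sequence) : bool :=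
  `[< null_seq (fun k => p (sval u k - sval v k)) >].

Lemma null_distb_refl : reflexive null_distb.
Proof.
move=> u; apply/asboolP; rewrite (_ : (fun _ => _) = fun=> 0); last first.
  by apply/funext => k; rewrite subrr csn0.
exact: cvg_cst.
Qed.

Lemma null_distb_sym : symmetric null_distb.
Proof.
by move=> u v; apply/asboolP/asboolP => h;
  apply: null_seq_le h => k; rewrite csn_ge0 csnC lexx.
Qed.

Lemma null_distb_trans : transitive null_distb.
Proof.
move=> v u w /asboolP h /asboolP h'; apply/asboolP.
by apply: null_seq_le (null_seqD h h') => k; rewrite csn_ge0 csn_tri.
Qed.

Canonical null_distb_equiv :=
  EquivRel null_distb null_distb_refl null_distb_sym null_distb_trans.

Definition completion : Type := {eq_quot null_distb}%qT.

HB.instance Definition _ := Choice.on completion.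

(** The completion is the quotient of the Cauchy sequences by the null
    sequences. The axioms of a *-algebra hold for sequences entry by entry, so
    they pass to classes through [cplt_eq]. *)
Definition cplt_class u (hu : cauchy_seq p u) : completion :=
  (\pi_({eq_quot null_distb}%qT) (exist _ u hu))%qT.

Definition cplt_seq (x : completion) : nat -> A :=
  sval (repr (x : {eq_quot null_distb}%qT)).

Lemma cplt_seq_cauchy x : cauchy_seq p (cplt_seq x).
Proof. exact: (svalP (repr (x : {eq_quot null_distb}%qT))). Qed.

Lemma cplt_classP u v (hu : cauchy_seq p u) (hv : cauchy_seq p v) :
  cplt_class hu = cplt_class hv <-> null_seq (fun k => p (u k - v k)).
Proof. by split=> [/eqquotP/asboolP //|h]; apply/eqquotP/asboolP. Qed.

Lemma cplt_seqK x : cplt_class (cplt_seq_cauchy x) = x.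
Proof.
rewrite -[RHS](reprK (x : {eq_quot null_distb}%qT)) /cplt_class; congr (\pi _)%qT.
by move: (cplt_seq_cauchy x); rewrite /cplt_seq; case: repr => u hu /= hu'; congr exist.
Qed.

Lemma cplt_classK u (hu : cauchy_seq p u) :
  null_seq (fun k => p (cplt_seq (cplt_class hu) k - u k)).
Proof. by apply/(cplt_classP (cplt_seq_cauchy _) hu); rewrite cplt_seqK. Qed.

Lemma cplt_ind (P : completion -> Prop) :
  (forall u (hu : cauchy_seq p u), P (cplt_class hu)) -> forall x, P x.
Proof. by move=> h x; rewrite -(cplt_seqK x). Qed.

Lemma cplt_eq u v (hu : cauchy_seq p u) (hv : cauchy_seq p v) :
  u =1 v -> cplt_class hu = cplt_class hv.
Proof. by move=> /funext uv; case: _ / uv hv => hv; congr cplt_class. Qed.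

Definition cplt_const a := cplt_class (cauchy_seq_cst p a).
Definition cplt_add x y :=
  cplt_class (cauchy_seqD (cplt_seq_cauchy x) (cplt_seq_cauchy y)).
Definition cplt_scale c x := cplt_class (cauchy_seqZ c (cplt_seq_cauchy x)).
Definition cplt_mul x y :=
  cplt_class (cauchy_seqM (cplt_seq_cauchy x) (cplt_seq_cauchy y)).
Definition cplt_star x := cplt_class (cauchy_seq_star (cplt_seq_cauchy x)).

Section OperationsOnClasses.
Variables (u v : nat -> A) (hu : cauchy_seq p u) (hv : cauchy_seq p v).

Lemma cplt_addE :
  cplt_add (cplt_class hu) (cplt_class hv) = cplt_class (cauchy_seqD hu hv).
Proof.
apply/cplt_classP.
apply: null_seq_le (null_seqD (cplt_classK hu) (cplt_classK hv)) => k.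
by rewrite csn_ge0 opprD addrACA csn_leD.
Qed.

Lemma cplt_scaleE c :
  cplt_scale c (cplt_class hu) = cplt_class (cauchy_seqZ c hu).
Proof.
apply/cplt_classP.
apply: null_seq_le (null_seqM (Normc.normc c) (cplt_classK hu)) => k.
by rewrite csn_ge0 -scalerBr csnZ lexx.
Qed.

Lemma cplt_starE :
  cplt_star (cplt_class hu) = cplt_class (cauchy_seq_star hu).
Proof.
apply/cplt_classP; apply: null_seq_le (cplt_classK hu) => k.
by rewrite csn_ge0 -starB csn_star lexx.
Qed.

Lemma cplt_mulE :
  cplt_mul (cplt_class hu) (cplt_class hv) = cplt_class (cauchy_seqM hu hv).
Proof.
apply/cplt_classP.
have [M hM] := cauchy_seq_bounded (cplt_seq_cauchy (cplt_class hu)).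
have [M' hM'] := cauchy_seq_bounded hv.
apply: null_seq_le (null_seqD (null_seqM M (cplt_classK hv))
  (null_seqM M' (cplt_classK hu))) => k.
set a := cplt_seq _ k; set b := cplt_seq _ k; rewrite csn_ge0 /=.
have -> : a * b - u k * v k = a * (b - v k) + (a - u k) * v k.
  by rewrite mulrBr mulrBl addrA subrK.
apply: le_trans (csn_leD _ _ _) _; apply: lerD.
  apply: le_trans (csn_leM _ _ _) _.
  by apply: ler_wpM2r; rewrite ?csn_ge0 ?hM.
apply: le_trans (csn_leM _ _ _) _; rewrite mulrC.
by apply: ler_wpM2r; rewrite ?csn_ge0 ?hM'.
Qed.

End OperationsOnClasses.

Let opE := (cplt_addE, cplt_scaleE, cplt_starE, cplt_mulE).

Lemma cplt_addA : associative cplt_add.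
Proof.
elim/cplt_ind=> u hu; elim/cplt_ind=> v hv; elim/cplt_ind=> w hw.
by rewrite !opE; apply: cplt_eq => k; rewrite addrA.
Qed.
Lemma cplt_addC : commutative cplt_add.
Proof.
elim/cplt_ind=> u hu; elim/cplt_ind=> v hv.
by rewrite !opE; apply: cplt_eq => k; rewrite addrC.
Qed.
Lemma cplt_add0 : left_id (cplt_const 0) cplt_add.
Proof.
by elim/cplt_ind=> u hu; rewrite opE; apply: cplt_eq => k; rewrite add0r.
Qed.
Lemma cplt_addN : left_inverse (cplt_const 0) (cplt_scale (-1)) cplt_add.
Proof.
elim/cplt_ind=> u hu; rewrite !opE; apply: cplt_eq => k.
by rewrite scaleN1r addNr.
Qed.

HB.instance Definition _ :=
  GRing.isZmodule.Build completion cplt_addA cplt_addC cplt_add0 cplt_addN.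

Lemma cplt_mulA : associative cplt_mul.
Proof.
elim/cplt_ind=> u hu; elim/cplt_ind=> v hv; elim/cplt_ind=> w hw.
by rewrite !opE; apply: cplt_eq => k; rewrite mulrA.
Qed.
Lemma cplt_mul1l : left_id (cplt_const 1) cplt_mul.
Proof.
by elim/cplt_ind=> u hu; rewrite opE; apply: cplt_eq => k; rewrite mul1r.
Qed.
Lemma cplt_mul1r : right_id (cplt_const 1) cplt_mul.
Proof.
by elim/cplt_ind=> u hu; rewrite opE; apply: cplt_eq => k; rewrite mulr1.
Qed.
Lemma cplt_mulDl : left_distributive cplt_mul cplt_add.
Proof.
elim/cplt_ind=> u hu; elim/cplt_ind=> v hv; elim/cplt_ind=> w hw.
by rewrite !opE; apply: cplt_eq => k; rewrite mulrDl.
Qed.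
Lemma cplt_mulDr : right_distributive cplt_mul cplt_add.
Proof.
elim/cplt_ind=> u hu; elim/cplt_ind=> v hv; elim/cplt_ind=> w hw.
by rewrite !opE; apply: cplt_eq => k; rewrite mulrDr.
Qed.
Lemma cplt_one_neq0 : cplt_const 1 != cplt_const 0.
Proof.
apply/eqP => /cplt_classP h; have /eqP := csn1 p; apply/negP.
have : p 1 = 0.
  by rewrite -[1]subr0; exact: seq_lim_uniq (cvg_cst _) h.
by move=> ->; rewrite eq_sym oner_eq0.
Qed.

HB.instance Definition _ := GRing.Zmodule_isNzRing.Build completion
  cplt_mulA cplt_mul1l cplt_mul1r cplt_mulDl cplt_mulDr cplt_one_neq0.

Lemma cplt_scaleA a b x : cplt_scale a (cplt_scale b x) = cplt_scale (a * b) x.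
Proof.
by elim/cplt_ind: x => u hu; rewrite !opE; apply: cplt_eq => k; rewrite scalerA.
Qed.
Lemma cplt_scale1 : left_id 1 cplt_scale.
Proof.
by elim/cplt_ind=> u hu; rewrite opE; apply: cplt_eq => k; rewrite scale1r.
Qed.
Lemma cplt_scaleDr : right_distributive cplt_scale +%R.
Proof.
move=> c; elim/cplt_ind=> u hu; elim/cplt_ind=> v hv.
by rewrite /GRing.add /= !opE; apply: cplt_eq => k; rewrite scalerDr.
Qed.
Lemma cplt_scaleDl x : {morph cplt_scale^~ x : a b / a + b}.
Proof.
move=> a b; elim/cplt_ind: x => u hu.
by rewrite [RHS]/GRing.add /= !opE; apply: cplt_eq => k; rewrite scalerDl.
Qed.

HB.instance Definition _ := GRing.Zmodule_isLmodule.Build R[i] completion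
  cplt_scaleA cplt_scale1 cplt_scaleDr cplt_scaleDl.

Lemma cplt_scaleAl (c : R[i]) (x y : completion) : c *: (x * y) = (c *: x) * y.
Proof.
elim/cplt_ind: x => u hu; elim/cplt_ind: y => v hv.
rewrite /GRing.scale /GRing.mul /= !opE.
by apply: cplt_eq => k; exact: scalerAl.
Qed.
Lemma cplt_scaleAr (c : R[i]) (x y : completion) : c *: (x * y) = x * (c *: y).
Proof.
elim/cplt_ind: x => u hu; elim/cplt_ind: y => v hv.
rewrite /GRing.scale /GRing.mul /= !opE.
by apply: cplt_eq => k; exact: scalerAr.
Qed.

HB.instance Definition _ :=
  GRing.LSemiModule_isLSemiAlgebra.Build R[i] completion cplt_scaleAl.
HB.instance Definition _ :=
  GRing.LSemiAlgebra_isSemiAlgebra.Build R[i] completion cplt_scaleAr.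

Lemma cplt_starD (x y : completion) :
  cplt_star (x + y) = cplt_star x + cplt_star y.
Proof.
elim/cplt_ind: x => u hu; elim/cplt_ind: y => v hv.
by rewrite /GRing.add /= !opE; apply: cplt_eq => k; exact: starD.
Qed.
Lemma cplt_starZ (c : R[i]) (x : completion) :
  cplt_star (c *: x) = Num.conj c *: cplt_star x.
Proof.
elim/cplt_ind: x => u hu.
by rewrite /GRing.scale /= !opE; apply: cplt_eq => k; exact: starZ.
Qed.
Lemma cplt_starM (x y : completion) :
  cplt_star (x * y) = cplt_star y * cplt_star x.
Proof.
elim/cplt_ind: x => u hu; elim/cplt_ind: y => v hv.
by rewrite /GRing.mul /= !opE; apply: cplt_eq => k; exact: starM.
Qed.
Lemma cplt_starK (x : completion) : cplt_star (cplt_star x) = x.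
Proof.
by elim/cplt_ind: x => u hu; rewrite !opE; apply: cplt_eq => k; exact: starK.
Qed.

HB.instance Definition _ := isStarAlgebra.Build R[i] completion
  cplt_starD cplt_starZ cplt_starM cplt_starK.

(** By [cplt_norm_cvg] any sequence of the class gives the same limit, so the
    arbitrary representative [cplt_seq x] does no harm. *)
Definition cplt_norm (x : completion) : R := lim ((p \o cplt_seq x) @ \oo).

Lemma cplt_norm_cvg u (hu : cauchy_seq p u) :
  (p \o u) @ \oo --> cplt_norm (cplt_class hu).
Proof.
have hl := cauchy_seq_cvg (cplt_seq_cauchy (cplt_class hu)).
have h : null_seq (fun k => p (u k) - p (cplt_seq (cplt_class hu) k)).
  have h0 := cplt_classK hu; have /cvgN h1 := h0; rewrite oppr0 in h1.
  apply: (squeeze_cvgr _ h1 h0); near=> k.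
  by rewrite -ler_norml distrC csn_dist.
exact: null_seq_cvg h hl.
Unshelve. all: by end_near. Qed.

Arguments cplt_norm_cvg {u} hu.

Lemma cplt_norm_eqlim u (hu : cauchy_seq p u) (l : R) :
  (p \o u) @ \oo --> l -> cplt_norm (cplt_class hu) = l.
Proof. exact: seq_lim_uniq (cplt_norm_cvg hu). Qed.

Lemma cplt_norm_const a : cplt_norm (cplt_const a) = p a.
Proof. by apply: cplt_norm_eqlim; exact: cvg_cst. Qed.

Lemma cplt_norm_le u (hu : cauchy_seq p u) (c : R) N :
  (forall k, (N <= k)%N -> p (u k) <= c) -> cplt_norm (cplt_class hu) <= c.
Proof.
move=> h; have hc := cplt_norm_cvg hu.
rewrite -(cvg_lim _ hc); last exact: norm_hausdorff.
apply: limr_le; last by exists N => // k; exact: h.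
by apply/cvg_ex; exists (cplt_norm (cplt_class hu)).
Qed.

Lemma cplt_norm_eq0 (x : completion) : cplt_norm x = 0 -> x = 0.
Proof.
elim/cplt_ind: x => u hu h; apply/cplt_classP.
have := cplt_norm_cvg hu; rewrite h.
by under [X in _ -> null_seq X]funext do rewrite subr0.
Qed.

Lemma cplt_normD_le (x y : completion) :
  cplt_norm (x + y) <= cplt_norm x + cplt_norm y.
Proof.
elim/cplt_ind: x => u hu; elim/cplt_ind: y => v hv.
rewrite /GRing.add /= opE.
apply: ler_cvg_to (cplt_norm_cvg (cauchy_seqD hu hv))
  (cvgD (cplt_norm_cvg hu) (cplt_norm_cvg hv)) _.
by near=> k; exact: csn_leD.
Unshelve. all: by end_near. Qed.

Lemma cplt_normM_le (x y : completion) :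
  cplt_norm (x * y) <= cplt_norm x * cplt_norm y.
Proof.
elim/cplt_ind: x => u hu; elim/cplt_ind: y => v hv.
rewrite /GRing.mul /= opE.
apply: ler_cvg_to (cplt_norm_cvg (cauchy_seqM hu hv))
  (cvgM (cplt_norm_cvg hu) (cplt_norm_cvg hv)) _.
by near=> k; exact: csn_leM.
Unshelve. all: by end_near. Qed.

Lemma cplt_normZ (c : R[i]) (x : completion) :
  cplt_norm (c *: x) = Normc.normc c * cplt_norm x.
Proof.
elim/cplt_ind: x => u hu; rewrite /GRing.scale /= opE.
apply: cplt_norm_eqlim.
rewrite (_ : p \o _ = cst (Normc.normc c) * (p \o u)); last first.
  by apply/funext => k; rewrite [RHS]/GRing.mul /= csnZ.
exact: cvgM (cvg_cst _) (cplt_norm_cvg hu).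
Qed.

Lemma cplt_norm_star (x : completion) :
  cplt_norm (star x * x) = cplt_norm x ^+ 2.
Proof.
elim/cplt_ind: x => u hu; rewrite /star /GRing.mul /= !opE.
apply: cplt_norm_eqlim; rewrite expr2.
rewrite (_ : p \o _ = (p \o u) * (p \o u)); last first.
  by apply/funext => k; rewrite [RHS]/GRing.mul /= csn_star_mul.
exact: cvgM (cplt_norm_cvg hu) (cplt_norm_cvg hu).
Qed.

Lemma cplt_subE u v (hu : cauchy_seq p u) (hv : cauchy_seq p v) :
  cplt_class hu - cplt_class hv = cplt_class (cauchy_seqD hu (cauchy_seqZ (-1) hv)).
Proof. by rewrite -cplt_addE -cplt_scaleE. Qed.

Lemma cplt_normB_const u (hu : cauchy_seq p u) (a : A) (c : R) N :
  (forall k, (N <= k)%N -> p (u k - a) <= c) ->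
  cplt_norm (cplt_class hu - cplt_const a) <= c.
Proof.
move=> h; rewrite cplt_subE; apply: (@cplt_norm_le _ _ _ N) => k Nk.
by rewrite scaleN1r; exact: h.
Qed.

Lemma cplt_norm1_neq0 : cplt_norm 1 != 0.
Proof. by rewrite cplt_norm_const csn1 oner_eq0. Qed.

Definition cplt_csn : cstar_seminorm completion := CStarSeminorm
  cplt_normD_le cplt_normZ cplt_normM_le cplt_norm_star cplt_norm1_neq0.

Lemma cplt_dense (x : completion) (d : R) : 0 < d ->
  exists a : A, cplt_csn (x - cplt_const a) < d.
Proof.
elim/cplt_ind: x => u hu d0; have [e he h] := hu.
have e0 k : 0 <= e k by apply: le_trans (h k k k _ _); rewrite ?csn_ge0.
have [N hN] := (null_seqP e0).1 he _ d0.
exists (u N); apply: le_lt_trans (hN N (leqnn N)).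
by apply: (@cplt_normB_const _ _ _ _ N) => k Nk; exact: h.
Qed.

Lemma cplt_constB a b : cplt_const a - cplt_const b = cplt_const (a - b).
Proof. by rewrite cplt_subE; apply: cplt_eq => k; rewrite scaleN1r. Qed.

(** A Cauchy sequence x in the completion converges to the class of a diagonal
    sequence v in A, where v_i approximates a term x_(m i) from which on x varies
    by less than 1/(i+1). *)
Lemma cplt_complete (x : nat -> completion) :
  (forall e : R, 0 < e -> exists N : nat, forall j k : nat,
     (N <= j)%N -> (N <= k)%N -> cplt_norm (x j - x k) < e) ->
  exists l : completion, forall e : R, 0 < e -> exists N : nat, forall k : nat,
     (N <= k)%N -> cplt_norm (x k - l) < e.
Proof.
move=> hx; pose d k := @harmonic R k.
have d0 k : 0 < d k by rewrite /d /= invr_gt0 ltr0n.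
have dle N k : (N <= k)%N -> d k <= d N.
  by move=> Nk; rewrite /d /= lef_pV2 ?posrE ?ltr0n // ler_nat ltnS.
have /choice[m hm] : forall i, exists N : nat, forall j k : nat,
    (N <= j)%N -> (N <= k)%N -> cplt_csn (x j - x k) < d i.
  by move=> i; exact: hx.
have /choice[v hv] : forall i, exists a, cplt_csn (x (m i) - cplt_const a) < d i.
  by move=> i; exact: cplt_dense.
have hxv i k : (m i <= k)%N -> cplt_csn (x k - cplt_const (v i)) <= 2 * d i.
  move=> ik; apply: le_trans (csn_tri _ _ (x (m i)) _) _.
  by have := hm i _ _ ik (leqnn _); have := hv i; lra.
have vB N j k : (N <= j)%N -> (N <= k)%N -> p (v j - v k) <= 4 * d N.
  move=> Nj Nk; rewrite -cplt_norm_const -cplt_constB.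
  have := hxv _ _ (leq_maxl (m j) (m k)); have := hxv _ _ (leq_maxr (m j) (m k)).
  set y := x _ => hk hj; apply: le_trans (csn_tri cplt_csn _ y _) _.
  by rewrite csnC; have := dle _ _ Nj; have := dle _ _ Nk; lra.
have cv : cauchy_seq p v.
  by exists (fun k => 4 * d k); [exact/null_seqM/null_seq_harmonic|exact: vB].
exists (cplt_class cv) => e e0.
have [|N hN] := (null_seqP (fun k => ltW (d0 k))).1 (@null_seq_harmonic R) (e / 6).
  by rewrite divr_gt0.
exists (m N) => k /hxv hk.
apply: le_lt_trans (csn_tri cplt_csn _ (cplt_const (v N)) _) _.
have := hN N (leqnn N); rewrite [cplt_csn (cplt_const (v N) - _)]csnC.
have : cplt_csn (cplt_class cv - cplt_const (v N)) <= 4 * d N.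
  by apply: (@cplt_normB_const _ _ _ _ N) => j Nj; exact: vB.
by lra.
Qed.

HB.instance Definition _ := isCStarAlgebra.Build R completion
  cplt_norm_eq0 cplt_normD_le cplt_normZ cplt_normM_le cplt_norm_star
  cplt_complete.

End CauchySequences.

(** * Automatic contractivity, and extension from a dense subalgebra *)

Section StarHom.
Variables (K : numClosedFieldType) (A B : starAlgType K) (f : A -> B).
Hypothesis hf : star_hom f.

Lemma star_hom0 : f 0 = 0.
Proof. by case: hf => _ fZ _ _ _; rewrite -[in LHS](scale0r (0 : A)) fZ scale0r. Qed.

Lemma star_homB x y : f (x - y) = f x - f y.
Proof. by case: hf => fD fZ _ _ _; rewrite -scaleN1r fD fZ scaleN1r. Qed.

Lemma star_hom_sum (I : Type) (r : seq I) (P : pred I) (F : I -> A) :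
  f (\sum_(i <- r | P i) F i) = \sum_(i <- r | P i) f (F i).
Proof. by case: hf => fD _ _ _ _; exact: (big_morph f fD star_hom0). Qed.

Lemma star_hom_prod (I : Type) (r : seq I) (P : pred I) (F : I -> A) :
  f (\prod_(i <- r | P i) F i) = \prod_(i <- r | P i) f (F i).
Proof. by case: hf => _ _ f1 fM _; exact: (big_morph f fM f1). Qed.

Lemma star_homX x k : f (x ^+ k) = f x ^+ k.
Proof.
case: hf => _ _ f1 fM _; elim: k => [|k IH]; first by rewrite !expr0.
by rewrite !exprS fM IH.
Qed.

End StarHom.

Section CStarLimits.
Variables (R : realType) (B : cstarAlgType R).

Lemma cnorm1_neq0 : cnorm (1 : B) != 0.
Proof. by apply/eqP => /cnorm_eq0/eqP; apply/negP; exact: oner_neq0. Qed.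

Definition cnorm_csn : cstar_seminorm B := CStarSeminorm
  (@cnormD_le R B) (@cnormZ R B) (@cnormM_le R B) (@cnorm_star R B) cnorm1_neq0.

Lemma clim_uniq (u : nat -> B) a b :
  slim cnorm_csn u a -> slim cnorm_csn u b -> a = b.
Proof. by move=> ha hb; apply/subr0_eq/cnorm_eq0; exact: slim_uniq ha hb. Qed.

Lemma cstar_complete (u : nat -> B) :
  (forall d : R, 0 < d -> exists N, forall j k,
    (N <= j)%N -> (N <= k)%N -> cnorm (u j - u k) < d) ->
  exists l, slim cnorm_csn u l.
Proof.
move=> /cnorm_complete[l hl]; exists l.
by apply/null_seqP => // k; exact: (csn_ge0 cnorm_csn).
Qed.

Lemma cauchy_clim (u : nat -> B) :
  cauchy_seq cnorm_csn u -> exists l, slim cnorm_csn u l.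
Proof.
move=> [e he hu]; apply: cstar_complete => d d0.
have e0 k : 0 <= e k by apply: le_trans (hu k k k _ _); rewrite ?csn_ge0.
have [N hN] := (null_seqP e0).1 he d d0.
by exists N => j k Nj Nk; apply: le_lt_trans (hN N (leqnn N)); exact: hu.
Qed.

End CStarLimits.

Section SquareRoot.
Variables (R : realType) (B : cstarAlgType R).
Local Notation p := (@cnorm_csn R B).
Local Notation half := ((2^-1 : R)%:C).

Lemma normc_half : Normc.normc half = 2^-1.
Proof. by rewrite normc_real ger0_norm // invr_ge0 ler0n. Qed.

Lemma half_double (x : B) : half *: x + half *: x = x.
Proof.
rewrite -scalerDl -rmorphD /= (_ : 2^-1 + 2^-1 = 1 :> R) ?scale1r //.
by lra.
Qed.

(** Putting y for 1 - sqrt(1 - a), the equation (1 - y)^2 = 1 - a becomes the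
    fixed point equation y = (a + y^2) / 2, whose right-hand side is a contraction
    of the ball of radius |a| < 1. The limit y of its iterates inherits from them
    self-adjointness and commutation with whatever commutes with a. *)
Lemma cstar_sqrt1B (a : B) : star a = a -> cnorm a < 1 ->
  exists y, [/\ (1 - y) * (1 - y) = 1 - a, star y = y &
    forall h, h * a = a * h -> h * y = y * h].
Proof.
move=> sa; rewrite -[cnorm a]/(p a); set r := p a => r1.
have r0 : 0 <= r by exact: csn_ge0.
pose F y := half *: (a + y * y).
pose y k := iter k F 0.
have Fle x : p x <= r -> p (F x) <= r.
  move=> xr; rewrite csnZ normc_half.
  have : p (x * x) <= r.
    apply: le_trans (csn_leM _ _ _) _; rewrite -[leRHS]mulr1.
    apply: ler_pM; rewrite ?csn_ge0 //; lra.
  by have := csn_leD p a (x * x); rewrite -/r; lra.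
have yle k : p (y k) <= r by elim: k => [|k IH]; rewrite ?csn0 //=; exact: Fle.
have Fcontr x z : p x <= r -> p z <= r -> p (F x - F z) <= r * p (x - z).
  move=> xr zr; rewrite -scalerBr csnZ normc_half opprD addrACA subrr add0r.
  have -> : x * x - z * z = x * (x - z) + (x - z) * z.
    by rewrite mulrBr mulrBl addrA subrK.
  have h1 : p (x * (x - z)) <= r * p (x - z).
    by apply: le_trans (csn_leM _ _ _) _; rewrite ler_wpM2r ?csn_ge0.
  have h2 : p ((x - z) * z) <= r * p (x - z).
    by apply: le_trans (csn_leM _ _ _) _; rewrite mulrC ler_wpM2r ?csn_ge0.
  by have := csn_leD p (x * (x - z)) ((x - z) * z); lra.
have yB N m : p (y (N + m)%N - y N) <= r ^+ N.
  elim: N => [|N IH]; first by rewrite subr0 expr0 (le_trans (yle _)) // ltW.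
  rewrite addSn /=; apply: le_trans (Fcontr _ _ (yle _) (yle _)) _.
  by rewrite exprS ler_wpM2l.
have geo : null_seq (fun k => r ^+ k).
  by apply: cvg_expr; rewrite ger0_norm.
have cy : cauchy_seq p y.
  exists (fun k => 2 * r ^+ k); first exact: null_seqM geo.
  move=> N j k Nj Nk; rewrite -(subnKC Nj) -(subnKC Nk).
  apply: le_trans (csn_tri _ _ (y N) _) _.
  have := yB N (j - N)%N; have := yB N (k - N)%N.
  by rewrite [p (y N - _)]csnC; lra.
have [l hl] := cauchy_clim cy.
have lE : l = half *: (a + l * l).
  apply: (@clim_uniq _ _ (fun k => y k.+1)).
    by rewrite /slim /null_seq (cvg_shiftS (fun k => p (y k - l))).
  exact/slimZ/slimD/slimM/hl/hl/slim_cst.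
exists l; split.
- have ll : l + l = a + l * l by rewrite {1 2}lE half_double.
  have -> : a = l + l - l * l by rewrite ll addrK.
  rewrite mulrBl mul1r mulrBr mulr1 !opprB -addrA; congr (_ + _).
  by rewrite addrCA opprD.
- apply: clim_uniq (slim_star hl) _.
  suff yS k : star (y k) = y k by under [X in slim _ X]funext do rewrite yS.
  elim: k => [|k IH]; first exact: star0.
  by rewrite /= starZ starD starM sa IH [Num.conj _]conjc_real.
- move=> h ha; have yh k : h * y k = y k * h.
    elim: k => [|k IH]; first by rewrite mulr0 mul0r.
    rewrite /= -scalerAr -scalerAl mulrDr mulrDl ha; congr (_ *: (_ + _)).
    by rewrite mulrA IH -mulrA IH mulrA.
  apply: clim_uniq (slimM (slim_cst _ h) hl) _.
  under [X in slim _ X]funext do rewrite yh.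
  exact: slimM hl (slim_cst _ h).
Qed.

(** A unitary has norm 1 under every C*-seminorm and every *-homomorphism, so
    writing h as the mean of a unitary and its adjoint controls the norm of the
    images of h. *)
Lemma cstar_unitary_dilation (h : B) : star h = h -> cnorm h < 1 ->
  exists u, star u * u = 1 /\ h = half *: (u + star u).
Proof.
move=> sh h1.
have h0 : 0 <= cnorm h by exact: (csn_ge0 p).
have [||y [y2 sy cy]] := @cstar_sqrt1B (h * h); first by rewrite starM sh.
  rewrite -{1}sh cnorm_star; by rewrite expr2; nra.
have sE : star (1 - y) = 1 - y by rewrite starB star1 sy.
have hs : h * (1 - y) = (1 - y) * h by rewrite mulrBr mulrBl mulr1 mul1r cy ?mulrA.
move: (1 - y) y2 sE hs => s s2 ss hs.
have su : star (h + 'i *: s) = h - 'i *: s.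
  rewrite starD sh starZ ss -[Num.conj 'i]/('i^*)%C /= -scaleNr.
  by congr (_ + _ *: _); apply/eqP; rewrite eq_complex /= oppr0 !eqxx.
(* s is sqrt(1 - h^2) and commutes with h, so that h + i s is unitary *)
exists (h + 'i *: s); rewrite su; split.
  rewrite mulrBl !mulrDr -!scalerAl -!scalerAr scalerA hs opprD addrA addrK.
  have -> : 'i * 'i = -1 :> R[i] by rewrite -expr2 sqr_i.
  by rewrite scaleN1r opprK s2 addrC subrK.
by rewrite addrACA subrr addr0 scalerDr half_double.
Qed.

End SquareRoot.

(** For self-adjoint h of norm < 1 the image of h is a mean of two unitaries,
    hence of norm at most 1; scaling gives the bound for all self-adjoint h, and
    the C*-identity for all x. *)
Lemma star_hom_contractive (R : realType) (B C : cstarAlgType R) (g : B -> C) :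
  star_hom g -> forall x, cnorm (g x) <= cnorm x.
Proof.
move=> hg; have [gD gZ g1 gM gS] := hg.
pose pB := @cnorm_csn R B; pose pC := @cnorm_csn R C.
have sa1 h : star h = h -> cnorm h < 1 -> cnorm (g h) <= 1.
  move=> sh /(cstar_unitary_dilation sh)[u [uu ->]].
  have gu : pC (g u) = 1.
    apply/eqP; rewrite -(@eqrXn2 _ 2) ?csn_ge0 ?ler01 // expr1n.
    by rewrite -csn_star_mul -gS -gM uu g1 csn1.
  rewrite gZ gD gS -[cnorm _]/(pC _) csnZ normc_half.
  by have := csn_leD pC (g u) (star (g u)); rewrite csn_star gu; lra.
have sa h : star h = h -> cnorm (g h) <= cnorm h.
  move=> sh; apply/ler_addgt0Pr => e e0.
  have d0 : 0 < cnorm h + e by rewrite ltr_wpDl // (csn_ge0 pB).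
  have dinv : Normc.normc ((cnorm h + e)^-1)%:C = (cnorm h + e)^-1.
    by rewrite normc_real ger0_norm // invr_ge0 ltW.
  have := sa1 (((cnorm h + e)^-1)%:C *: h).
  rewrite gZ !cnormZ dinv starZ sh [Num.conj _]conjc_real => /(_ erefl).
  rewrite mulrC ltr_pdivrMr // mul1r ltrDl => /(_ e0).
  by rewrite mulrC ler_pdivrMr // mul1r.
move=> x; rewrite -(@ler_pXn2r _ 2) ?nnegrE ?(csn_ge0 pB) ?(csn_ge0 pC) //.
by rewrite -!cnorm_star -gS -gM sa // starM starK.
Qed.

Section DenseUniversal.
Variables (R : realType) (A : starAlgType R[i]) (B : cstarAlgType R).
Variable phi : A -> B.
Hypothesis hphi : star_hom phi.
Hypothesis phi_dense : forall b (d : R), 0 < d -> exists a, cnorm (b - phi a) < d.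
Hypothesis phi_max : forall (C : cstarAlgType R) (f : A -> C), star_hom f ->
  forall a, cnorm (f a) <= cnorm (phi a).
Local Notation pB := (@cnorm_csn R B).

Lemma dense_seq b : exists u : nat -> A, slim pB (fun k => phi (u k)) b.
Proof.
have /choice[u hu] : forall k, exists a, cnorm (b - phi a) < @harmonic R k.
  by move=> k; apply: phi_dense; rewrite /= invr_gt0 ltr0n.
exists u; apply: null_seq_le (@null_seq_harmonic R) => k.
by rewrite csn_ge0 csnC /=; exact: ltW (hu k).
Qed.

(** As [phi] dominates [f], the image under [f] of any sequence whose image under
    [phi] converges is Cauchy, with a limit that depends on the limit in B only. *)
Lemma dense_extension (C : cstarAlgType R) (f : A -> C) : star_hom f ->
  exists g : B -> C, forall u b, slim pB (fun k => phi (u k)) b ->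
    slim (@cnorm_csn R C) (fun k => f (u k)) (g b).
Proof.
move=> hf; have fphi a a' : cnorm (f a - f a') <= cnorm (phi a - phi a').
  by rewrite -(star_homB hf) -(star_homB hphi); exact: phi_max.
have /choice[g hg] : forall b, exists c, forall u, slim pB (fun k => phi (u k)) b ->
    slim (@cnorm_csn R C) (fun k => f (u k)) c.
  move=> b; have [u hu] := dense_seq b.
  have [|c hc] := @cstar_complete R C (fun k => f (u k)).
    move=> d /(slim_cauchy hu)[N hN]; exists N => j k Nj Nk.
    by apply: le_lt_trans (fphi _ _) _; exact: hN.
  exists c => v hv.
  have h : null_seq (fun k => cnorm (phi (v k) - b) + cnorm (phi (u k) - b)).
    exact: null_seqD hv hu.
  apply: null_seq_le (null_seqD h hc) => k; rewrite csn_ge0 /=.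
  apply: le_trans (csn_tri (cnorm_csn C) _ (f (u k)) _) _; rewrite lerD2r.
  apply: le_trans (fphi _ _) _; apply: le_trans (csn_tri pB _ b _) _.
  by rewrite lerD2l (csnC pB).
by exists g => u b; exact: hg.
Qed.

(** The hypothesis [phi_max] makes every *-homomorphism extend; uniqueness of the
    extension, among homomorphisms not supposed continuous, is where
    [star_hom_contractive] enters. *)
Theorem dense_universal : universal_cstar phi.
Proof.
split=> // C f hf; have [g hg] := dense_extension hf.
have [fD fZ f1 fM fS] := hf; have [phiD phiZ phi1 phiM phiS] := hphi.
have gphi a : g (phi a) = f a.
  exact: clim_uniq (hg (fun=> a) _ (slim_cst _ _)) (slim_cst _ _).
exists g; split.
  split=> //; split.
  - move=> x y; have [u hu] := dense_seq x; have [v hv] := dense_seq y.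
    have h : slim pB (fun k => phi (u k + v k)) (x + y).
      by under [X in slim _ X]funext do rewrite phiD; exact: slimD.
    apply: clim_uniq (hg _ _ h) _.
    by under [X in slim _ X]funext do rewrite fD; apply: slimD; exact: hg.
  - move=> c x; have [u hu] := dense_seq x.
    have h : slim pB (fun k => phi (c *: u k)) (c *: x).
      by under [X in slim _ X]funext do rewrite phiZ; exact: slimZ.
    apply: clim_uniq (hg _ _ h) _.
    by under [X in slim _ X]funext do rewrite fZ; apply: slimZ; exact: hg.
  - by rewrite -phi1 gphi.
  - move=> x y; have [u hu] := dense_seq x; have [v hv] := dense_seq y.
    have h : slim pB (fun k => phi (u k * v k)) (x * y).
      by under [X in slim _ X]funext do rewrite phiM; exact: slimM.
    apply: clim_uniq (hg _ _ h) _.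
    by under [X in slim _ X]funext do rewrite fM; apply: slimM; exact: hg.
  - move=> x; have [u hu] := dense_seq x.
    have h : slim pB (fun k => phi (star (u k))) (star x).
      by under [X in slim _ X]funext do rewrite phiS; exact: slim_star.
    apply: clim_uniq (hg _ _ h) _.
    by under [X in slim _ X]funext do rewrite fS; apply: slim_star; exact: hg.
move=> g' [hg' g'phi]; apply/funext => x; have [u hu] := dense_seq x.
apply: clim_uniq (hg _ _ hu) _; apply: null_seq_le hu => k; rewrite csn_ge0 /=.
by rewrite -g'phi -(star_homB hg'); exact: star_hom_contractive.
Qed.

End DenseUniversal.

(** * Existence of the universal C*-algebra of the quantum sphere *)

Section CompletionUniversal.
Variables (R : realType) (A : starAlgType R[i]) (p : cstar_seminorm A).

Lemma cplt_const_hom : star_hom (@cplt_const R A p : A -> completion p).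
Proof.
split=> //.
- by move=> x y; rewrite /GRing.add /= cplt_addE; apply: cplt_eq.
- by move=> c x; rewrite [in RHS]/GRing.scale /= cplt_scaleE; apply: cplt_eq.
- by move=> x y; rewrite [in RHS]/GRing.mul /= cplt_mulE; apply: cplt_eq.
- by move=> x; rewrite [in RHS]/star /= cplt_starE; apply: cplt_eq.
Qed.

Definition pullback_csn (B : starAlgType R[i]) (pB : cstar_seminorm B) (f : A -> B)
  (hf : star_hom f) : cstar_seminorm A.
Proof.
exists (fun a => pB (f a)); case: hf => fD fZ f1 fM fS.
- by move=> x y; rewrite fD csn_leD.
- by move=> a x; rewrite fZ csnZ.
- by move=> x y; rewrite fM csn_leM.
- by move=> x; rewrite fM fS csn_star_mul.
- by rewrite f1 csn1_neq0.
Defined.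

Lemma completion_universal :
  (forall (p' : cstar_seminorm A) a, p' a <= p a) ->
  universal_cstar (@cplt_const R A p : A -> completion p).
Proof.
move=> pmax; apply: dense_universal.
- exact: cplt_const_hom.
- by move=> b d; exact: cplt_dense.
- move=> C f hf a; rewrite [leRHS]cplt_norm_const.
  exact: pmax (pullback_csn (cnorm_csn C) hf) a.
Qed.

End CompletionUniversal.

(** C*-seminorms on A stand for *-homomorphisms from A to C*-algebras: quantifying
    over the former avoids a supremum indexed by all C*-algebras. *)
Section MaximalSeminorm.
Variables (R : realType) (A : starAlgType R[i]) (p0 : cstar_seminorm A).
Variable M : A -> R.
Hypothesis leM : forall (p : cstar_seminorm A) a, p a <= M a.

Definition sup_csn a : R := sup (range (fun p : cstar_seminorm A => p a)).

Lemma le_sup_csn (p : cstar_seminorm A) a : p a <= sup_csn a.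
Proof.
apply: sup_upper_bound; last by exists p.
split; first by exists (p0 a), p0.
by exists (M a) => _ [p' _ <-].
Qed.

Lemma sup_csn_le a c : (forall p : cstar_seminorm A, p a <= c) -> sup_csn a <= c.
Proof.
move=> h; apply: ge_sup; first by exists (p0 a), p0.
by move=> _ [p _ <-].
Qed.

Lemma sup_csn_ge0 a : 0 <= sup_csn a.
Proof. exact: le_trans (csn_ge0 p0 a) (le_sup_csn _ _). Qed.

Definition max_csn : cstar_seminorm A.
Proof.
exists sup_csn.
- move=> x y; apply: sup_csn_le => p; apply: le_trans (csn_leD _ _ _) _.
  by apply: lerD; exact: le_sup_csn.
- move=> c x; have le d y : sup_csn (d *: y) <= Normc.normc d * sup_csn y.
    by apply: sup_csn_le => p; rewrite csnZ ler_wpM2l ?normc_ge0 ?le_sup_csn.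
  apply/eqP; rewrite eq_le le /=; have [->|c0] := eqVneq c 0.
    by rewrite Normc.normc0 mul0r sup_csn_ge0.
  have := le c^-1 (c *: x); rewrite scalerA mulVf // scale1r Normc.normcV.
  rewrite mulrC ler_pdivlMr 1?mulrC // lt_neqAle normc_ge0 andbT eq_sym.
  by apply: contra_neq c0; exact: Normc.eq0_normc.
- move=> x y; apply: sup_csn_le => p; apply: le_trans (csn_leM _ _ _) _.
  by apply: ler_pM; rewrite ?csn_ge0 ?le_sup_csn.
- move=> x; apply/eqP; rewrite eq_le; apply/andP; split.
    apply: sup_csn_le => p; rewrite csn_star_mul.
    by rewrite ler_pXn2r ?nnegrE ?csn_ge0 ?sup_csn_ge0 ?le_sup_csn.
  rewrite -[leRHS]sqr_sqrtr ?sup_csn_ge0 // ler_pXn2r ?nnegrE ?sup_csn_ge0 ?sqrtr_ge0 //.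
  apply: sup_csn_le => p; rewrite -[leLHS]ger0_norm ?csn_ge0 // -sqrtr_sqr.
  by rewrite ler_sqrt ?sup_csn_ge0 // -csn_star_mul le_sup_csn.
- apply/eqP => h; have := le_sup_csn p0 1; rewrite csn1 h.
  by rewrite leNgt ltr01.
Defined.

Lemma universal_cstar_exists :
  exists (B : cstarAlgType R) (phi : A -> B), universal_cstar phi.
Proof.
exists (completion max_csn), (cplt_const max_csn).
by apply: completion_universal => p a; exact: le_sup_csn.
Qed.

End MaximalSeminorm.

Section SphereBound.
Variables (R : realType) (n : nat) (q : R).
Hypotheses (hq0 : 0 <= q) (hq1 : q < 1).
Local Notation A := (qsphere n q).
Local Notation z := (@qsphere_z R n q).

(** The element x_k: the relations express every [z_i z_i^*] and [z_i^* z_i]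
    through x_i and x_(i+1). *)
Definition zz_tail (k : nat) : A := \sum_(j < n.+1 | (k <= j)%N) z j * star (z j).

Lemma zz_tail0 : zz_tail 0 = 1.
Proof. by have [_ _ _ <-] := qsphere_zP n q; apply: eq_bigl. Qed.

Lemma zz_tail_max : zz_tail n.+1 = 0.
Proof. by apply: big_pred0 => j; rewrite leqNgt ltn_ord. Qed.

Lemma z_starz (i : 'I_n.+1) : z i * star (z i) = zz_tail i - zz_tail i.+1.
Proof.
rewrite /zz_tail (bigD1 i) //= -addrA; set s := \sum_(_ < _ | _) _.
rewrite (_ : s = \sum_(j < n.+1 | (i < j)%N) z j * star (z j)) ?subrr ?addr0 //.
by apply: eq_bigl => j; rewrite andbC ltn_neqAle eq_sym.
Qed.

Lemma starz_z (i : 'I_n.+1) :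
  star (z i) * z i = zz_tail i - (q ^+ 2)%:C *: zz_tail i.+1.
Proof.
have [_ _ -> _] := qsphere_zP n q; rewrite z_starz -/(zz_tail i.+1).
by rewrite rmorphB scalerBl rmorph1 scale1r addrA subrK.
Qed.

Variable p : cstar_seminorm A.

(** Both [z_i z_i^*] and [z_i^* z_i] have seminorm [p(z_i)^2], and the second is
    [(1 - q^2) x_i + q^2 z_i z_i^*]; as [q < 1] the last term can be absorbed. *)
Lemma csn_z_le_tail (i : 'I_n.+1) : p (z i) ^+ 2 <= p (zz_tail i).
Proof.
have q2 : q ^+ 2 < 1 by rewrite expr_lt1.
have : p (star (z i) * z i) <= (1 - q ^+ 2) * p (zz_tail i) + q ^+ 2 * p (z i) ^+ 2.
  have -> : star (z i) * z i =
      (1 - q ^+ 2)%:C *: zz_tail i + (q ^+ 2)%:C *: (z i * star (z i)).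
    rewrite starz_z z_starz rmorphB scalerBl rmorph1 scale1r scalerBr.
    by rewrite addrA subrK.
  apply: le_trans (csn_leD _ _ _) _; rewrite !csnZ !normc_real csn_mul_star.
  by rewrite !ger0_norm ?exprn_ge0 // subr_ge0 ltW.
rewrite csn_star_mul => h; rewrite -(@ler_pM2l _ (1 - q ^+ 2)) ?subr_gt0 //.
by move: h; rewrite !mulrBl; lra.
Qed.

(** The sharp bound is 1, but the factor 2 of the triangle inequality spares any
    use of positivity. *)
Lemma csn_tail_le k : (k <= n.+1)%N -> p (zz_tail k) <= 2 ^+ k.
Proof.
elim: k => [|k IH] kn; first by rewrite zz_tail0 csn1 expr0.
have -> : zz_tail k.+1 = zz_tail k - z (Ordinal kn) * star (z (Ordinal kn)).
  by rewrite z_starz opprB addrC subrK.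
apply: le_trans (csn_leB _ _ _) _; rewrite csn_mul_star.
have := csn_z_le_tail (Ordinal kn); have := IH (ltnW kn); rewrite (exprS _ k) /=; lra.
Qed.

Lemma csn_z_le (i : 'I_n.+1) : p (z i) <= 2 ^+ i.
Proof.
have h2 : 1 <= 2 ^+ i :> R by rewrite exprn_ege1 // ler1n.
rewrite -(@ler_pXn2r _ 2) ?nnegrE ?csn_ge0 ?(le_trans ler01 h2) //.
apply: le_trans (csn_z_le_tail i) _; apply: le_trans (csn_tail_le (ltnW _)) _ => //.
by rewrite expr2 ler_peMl // (le_trans ler01 h2).
Qed.

(** Uniformity over all C*-seminorms is what makes their supremum finite. *)
Fixpoint expr_bound (x : star_expr R[i] 'I_n.+1) : R :=
  match x with
  | Egen i => 2 ^+ i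
  | Ezero => 0
  | Eone => 1
  | Eadd x y => expr_bound x + expr_bound y
  | Eopp x => expr_bound x
  | Emul x y => expr_bound x * expr_bound y
  | Escale a x => Normc.normc a * expr_bound x
  | Estar x => expr_bound x
  end.

Lemma csn_expr_bound x : p (star_eval z x) <= expr_bound x.
Proof.
elim: x => /= [i|||x hx y hy|x hx|x hx y hy|a x hx|x hx].
- exact: csn_z_le.
- by rewrite csn0.
- by rewrite csn1.
- by apply: le_trans (csn_leD _ _ _) _; exact: lerD.
- by rewrite csnN.
- by apply: le_trans (csn_leM _ _ _) _; apply: ler_pM; rewrite ?csn_ge0.
- by rewrite csnZ ler_wpM2l ?normc_ge0.
- by rewrite csn_star.
Qed.

End SphereBound.

Lemma qsphere_exprP (R : realType) (n : nat) (q : R) (a : qsphere n q) :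
  exists x, a = star_eval (@qsphere_z R n q) x.
Proof. by exists (pr_repr a); rewrite star_eval_qsphere pr_reprK. Qed.

Definition normc_csn (R : realType) : cstar_seminorm (R[i]^o).
Proof.
exists (@Normc.normc R).
- exact: le_normcD.
- exact: Normc.normcM.
- by move=> x y; rewrite [leLHS]Normc.normcM.
- move=> x; rewrite [LHS]Normc.normcM expr2; congr (_ * _).
  by case: x => a b; rewrite /star /= sqrrN.
- by rewrite [X in X != _]Normc.normc1 oner_neq0.
Defined.

Section SphereCharacter.
Variables (R : realType) (n : nat) (q : R).

Lemma qsphere_character : exists f : qsphere n q -> R[i]^o, star_hom f.
Proof.
have [|f [[hf _] _]] := @qsphere_univ R n q R[i]^o (fun i => (i == ord0)%:R);
  last by exists f.
split => [i j ij|i j ij|i|].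
- have /negPf-> : j != ord0 by rewrite -lt0n; exact: leq_ltn_trans ij.
  by rewrite mul0r mulr0 scaler0.
- case: (eqVneq j ord0) ij => [->|_ _]; last by rewrite mulr0 mul0r scaler0.
  by move=> /negPf->; rewrite /star /= conjC0 mul0r mulr0 scaler0.
- rewrite big1 ?scaler0 ?addr0 1?mulrC // => j ij.
  have /negPf-> : j != ord0 by rewrite -lt0n; exact: leq_ltn_trans ij.
  by rewrite mul0r.
- rewrite (bigD1 ord0) //= big1 ?addr0 => [|j /negPf->]; last by rewrite mul0r.
  by rewrite [LHS]mul1r /star /= conjC1.
Qed.

End SphereCharacter.

Lemma qsphere_universal_exists (R : realType) (n : nat) (q : R) :
  0 <= q -> q < 1 ->
  exists (B : cstarAlgType R) (phi : qsphere n q -> B), universal_cstar phi.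
Proof.
move=> q0 q1; have [f hf] := qsphere_character n q.
have /choice[M hM] : forall a : qsphere n q, exists M,
    forall p : cstar_seminorm (qsphere n q), p a <= M.
  move=> a; have [x ->] := qsphere_exprP a.
  by exists (expr_bound x) => p; exact: csn_expr_bound.
apply: (@universal_cstar_exists _ _ (pullback_csn (normc_csn R) hf) M).
by move=> p a; exact: hM.
Qed.

(** * Adjointable operators and the seminorm of a representation *)

(** A complex space with inner product. C*-algebras arise by completing algebras
    of operators on it, for the operator norm, instead of the space itself. *)
Record preHilbert (R : realType) := PreHilbert {
  ph_sort :> lmodType R[i];
  ip : ph_sort -> ph_sort -> R[i];
  ipDl : forall u v w, ip (u + v) w = ip u w + ip v w;
  ipZl : forall a v w, ip (a *: v) w = a * ip v w;
  ip_conj : forall v w, ip w v = Num.conj (ip v w);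
  ip_ge0 : forall v, 0 <= ip v v;
  ip_eq0 : forall v, ip v v = 0 -> v = 0;
  ph_nontrivial : exists v : ph_sort, v != 0
}.

Section PreHilbertTheory.
Variables (R : realType) (H : preHilbert R).
Implicit Types u v w : H.

Lemma ip0l v : ip 0 v = 0.
Proof. by rewrite -(scale0r (0 : H)) ipZl mul0r. Qed.

Lemma ipDr u v w : ip u (v + w) = ip u v + ip u w.
Proof. by rewrite ip_conj ipDl rmorphD /= -!ip_conj. Qed.

Lemma ipZr a v w : ip v (a *: w) = Num.conj a * ip v w.
Proof. by rewrite ip_conj ipZl rmorphM /= -!ip_conj. Qed.

Lemma ipBl u v w : ip (u - v) w = ip u w - ip v w.
Proof. by rewrite -scaleN1r ipDl ipZl mulN1r. Qed.

Lemma ip_suml (I : Type) (r : seq I) (P : pred I) (F : I -> H) w :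
  ip (\sum_(i <- r | P i) F i) w = \sum_(i <- r | P i) ip (F i) w.
Proof.
apply: (big_morph (fun v => ip v w)) => [u v|]; [exact: ipDl|exact: ip0l].
Qed.

Lemma ip_ext u v : (forall w, ip u w = ip v w) -> u = v.
Proof. by move=> h; apply/subr0_eq/ip_eq0; rewrite ipBl h subrr. Qed.

Definition hnorm v : R := Num.sqrt (complex.Re (ip v v)).

Lemma hnorm_ge0 v : 0 <= hnorm v.
Proof. exact: sqrtr_ge0. Qed.

Lemma hnorm_sqr v : (hnorm v ^+ 2)%:C = ip v v.
Proof.
have := ip_ge0 v; rewrite /hnorm; case: (ip v v) => a b.
by rewrite lecE /= => /andP[/eqP-> a0]; rewrite sqr_sqrtr.
Qed.

Lemma hnorm_sqr_le v w : ip v v <= ip w w -> hnorm v <= hnorm w.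
Proof.
by rewrite -!hnorm_sqr lecR ler_pXn2r ?nnegrE ?hnorm_ge0.
Qed.

Lemma hnormZ a v : hnorm (a *: v) = Normc.normc a * hnorm v.
Proof.
have n0 := normc_ge0 a.
apply/eqP; rewrite -(@eqrXn2 _ 2) ?mulr_ge0 ?hnorm_ge0 //.
apply/eqP/(@complexI R); rewrite hnorm_sqr ipZl ipZr mulrA -normCK exprMn.
by rewrite rmorphM /= hnorm_sqr rmorphXn.
Qed.

Lemma hnorm_eq0 v : hnorm v = 0 -> v = 0.
Proof. by move=> h; apply: ip_eq0; rewrite -hnorm_sqr h expr0n. Qed.

Lemma hnorm0 : hnorm 0 = 0.
Proof. by rewrite /hnorm ip0l sqrtr0. Qed.

Lemma cauchy_schwarz v w : Normc.normc (ip v w) <= hnorm v * hnorm w.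
Proof.
have n0 := normc_ge0 (ip v w).
rewrite -(@ler_pXn2r _ 2) ?nnegrE ?mulr_ge0 ?hnorm_ge0 // -lecR.
rewrite exprMn [leRHS]rmorphM /= !hnorm_sqr rmorphXn /= -[(Normc.normc _)%:C]/(`|ip v w|).
have [w0|w0] := eqVneq (ip w w) 0.
  have c0 : ip v w = 0 by rewrite (ip_eq0 w0) ip_conj ip0l conjC0.
  by rewrite c0 w0 normr0 expr0n mulr0.
have b0 : 0 < ip w w by rewrite lt_neqAle eq_sym w0 ip_ge0.
have br : Num.conj (ip w w) = ip w w by rewrite -ip_conj.
have := ip_ge0 (ip w w *: v - ip v w *: w).
rewrite -scaleNr !(ipDl, ipDr, ipZl, ipZr) rmorphN /= br (ip_conj v w).
set a := ip v v; set b := ip w w; set c := ip v w.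
have -> : b * (b * a) + b * (- Num.conj c * c) +
    (- c * (b * Num.conj c) + - c * (- Num.conj c * b)) =
    b * (a * b - c * Num.conj c) by ring.
by rewrite pmulr_rge0 // subr_ge0 normCK.
Qed.

Lemma hnorm_leD v w : hnorm (v + w) <= hnorm v + hnorm w.
Proof.
rewrite -(@ler_pXn2r _ 2) ?nnegrE ?addr_ge0 ?hnorm_ge0 //.
have cs := cauchy_schwarz v w.
have re : complex.Re (ip v w) <= Normc.normc (ip v w).
  case: (ip v w) => x y /=; apply: le_trans (ler_norm _) _.
  by rewrite -sqrtr_sqr ler_sqrt ?lerDl ?sqr_ge0 // addr_ge0 ?sqr_ge0.
have : hnorm (v + w) ^+ 2 = hnorm v ^+ 2 + 2 * complex.Re (ip v w) + hnorm w ^+ 2.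
  have e u : hnorm u ^+ 2 = complex.Re (ip u u) by rewrite -hnorm_sqr.
  rewrite !e ipDl !ipDr (ip_conj v w).
  by case: (ip v v) (ip v w) (ip w w) => [? ?] [? ?] [? ?] /=; ring.
by move=> ->; rewrite sqrrD -mulr_natl; nra.
Qed.

End PreHilbertTheory.

Section Adjointable.
Variables (R : realType) (H : preHilbert R).

Definition has_adjoint (T T' : H -> H) := forall v w, ip (T v) w = ip v (T' w).

(** The existence of an adjoint forces T to be linear ([opD], [opZ]), and the
    adjoint is unique ([op_star_eq]). *)
Definition adjointable : Type := {T : H -> H | exists T', has_adjoint T T'}.

HB.instance Definition _ := gen_eqMixin adjointable.
HB.instance Definition _ := gen_choiceMixin adjointable.

Definition op_fun (T : adjointable) : H -> H := sval T.
Coercion op_fun : adjointable >-> Funclass.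

Definition mk_op T T' (h : has_adjoint T T') : adjointable :=
  exist _ T (ex_intro _ T' h).

Definition adjoint_fun (T : adjointable) : H -> H := sval (cid (svalP T)).

Lemma adjointP (T : adjointable) : has_adjoint T (adjoint_fun T).
Proof. exact: (svalP (cid (svalP T))). Qed.

Lemma op_ext (S T : adjointable) : S =1 T -> S = T.
Proof.
move: S T => [S hS] [T hT] /= /funext ST; case: _ / ST hT => hT.
by congr exist.
Qed.

Lemma has_adjoint_sym T T' : has_adjoint T T' -> has_adjoint T' T.
Proof. by move=> h v w; rewrite ip_conj -h -ip_conj. Qed.

Lemma opD (T : adjointable) u v : T (u + v) = T u + T v.
Proof. by apply: ip_ext => w; rewrite adjointP !ipDl !adjointP. Qed.

Lemma opZ (T : adjointable) a v : T (a *: v) = a *: T v.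
Proof. by apply: ip_ext => w; rewrite adjointP !ipZl !adjointP. Qed.

Fact has_adjoint0 : has_adjoint (fun=> 0) (fun=> 0).
Proof. by move=> v w; rewrite ip0l ip_conj ip0l conjC0. Qed.
Fact has_adjoint1 : has_adjoint id id.
Proof. by []. Qed.
Fact has_adjointD (S T : adjointable) :
  has_adjoint (fun v => S v + T v) (fun v => adjoint_fun S v + adjoint_fun T v).
Proof. by move=> v w; rewrite ipDl ipDr !adjointP. Qed.
Fact has_adjointZ a (T : adjointable) :
  has_adjoint (fun v => a *: T v) (fun v => Num.conj a *: adjoint_fun T v).
Proof. by move=> v w; rewrite ipZl ipZr conjCK adjointP. Qed.
Fact has_adjointM (S T : adjointable) :
  has_adjoint (fun v => S (T v)) (fun v => adjoint_fun T (adjoint_fun S v)).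
Proof. by move=> v w; rewrite !adjointP. Qed.

Definition op_zero := mk_op has_adjoint0.
Definition op_one := mk_op has_adjoint1.
Definition op_add S T := mk_op (has_adjointD S T).
Definition op_scale a T := mk_op (has_adjointZ a T).
Definition op_mul S T := mk_op (has_adjointM S T).
Definition op_star T := mk_op (has_adjoint_sym (adjointP T)).

Fact op_addA : associative op_add.
Proof. by move=> S T U; apply: op_ext => v; exact: addrA. Qed.
Fact op_addC : commutative op_add.
Proof. by move=> S T; apply: op_ext => v; exact: addrC. Qed.
Fact op_add0 : left_id op_zero op_add.
Proof. by move=> T; apply: op_ext => v; exact: add0r. Qed.
Fact op_addN : left_inverse op_zero (op_scale (-1)) op_add.
Proof. by move=> T; apply: op_ext => v; rewrite /= scaleN1r addNr. Qed.

HB.instance Definition _ :=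
  GRing.isZmodule.Build adjointable op_addA op_addC op_add0 op_addN.

Fact op_mulA : associative op_mul.
Proof. by move=> S T U; exact: op_ext. Qed.
Fact op_mul1l : left_id op_one op_mul.
Proof. by move=> T; exact: op_ext. Qed.
Fact op_mul1r : right_id op_one op_mul.
Proof. by move=> T; exact: op_ext. Qed.
Fact op_mulDl : left_distributive op_mul op_add.
Proof. by move=> S T U; exact: op_ext. Qed.
Fact op_mulDr : right_distributive op_mul op_add.
Proof. by move=> S T U; apply: op_ext => v; exact: opD. Qed.
Fact op_one_neq0 : op_one != op_zero.
Proof.
have [v v0] := ph_nontrivial H; apply: contra_neq v0 => h.
exact: (congr1 (fun T : adjointable => T v) h).
Qed.

HB.instance Definition _ := GRing.Zmodule_isNzRing.Build adjointable
  op_mulA op_mul1l op_mul1r op_mulDl op_mulDr op_one_neq0.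

Fact op_scaleA a b T : op_scale a (op_scale b T) = op_scale (a * b) T.
Proof. by apply: op_ext => v; exact: scalerA. Qed.
Fact op_scale1 : left_id 1 op_scale.
Proof. by move=> T; apply: op_ext => v; exact: scale1r. Qed.
Fact op_scaleDr : right_distributive op_scale +%R.
Proof. by move=> a S T; apply: op_ext => v; exact: scalerDr. Qed.
Fact op_scaleDl T : {morph op_scale^~ T : a b / a + b}.
Proof. by move=> a b; apply: op_ext => v; exact: scalerDl. Qed.

HB.instance Definition _ := GRing.Zmodule_isLmodule.Build R[i] adjointable
  op_scaleA op_scale1 op_scaleDr op_scaleDl.

Fact op_scaleAl (a : R[i]) (S T : adjointable) : a *: (S * T) = (a *: S) * T.
Proof. exact: op_ext. Qed.
Fact op_scaleAr (a : R[i]) (S T : adjointable) : a *: (S * T) = S * (a *: T).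
Proof. by apply: op_ext => v; rewrite [RHS]opZ. Qed.

HB.instance Definition _ :=
  GRing.LSemiModule_isLSemiAlgebra.Build R[i] adjointable op_scaleAl.
HB.instance Definition _ :=
  GRing.LSemiAlgebra_isSemiAlgebra.Build R[i] adjointable op_scaleAr.

Lemma op_star_eq (T : adjointable) T' : has_adjoint T T' -> op_star T =1 T'.
Proof.
by move=> h v; apply: ip_ext => w; rewrite ip_conj [in RHS]ip_conj -h -adjointP.
Qed.

Fact op_starD (S T : adjointable) : op_star (S + T) = op_star S + op_star T.
Proof. by apply: op_ext; apply: op_star_eq; exact: has_adjointD. Qed.
Fact op_starZ (a : R[i]) (T : adjointable) :
  op_star (a *: T) = Num.conj a *: op_star T.
Proof. by apply: op_ext; apply: op_star_eq; exact: has_adjointZ. Qed.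
Fact op_starM (S T : adjointable) : op_star (S * T) = op_star T * op_star S.
Proof. by apply: op_ext; apply: op_star_eq; exact: has_adjointM. Qed.
Fact op_starK (T : adjointable) : op_star (op_star T) = T.
Proof.
by apply: op_ext; apply: op_star_eq; exact/has_adjoint_sym/adjointP.
Qed.

HB.instance Definition _ := isStarAlgebra.Build R[i] adjointable
  op_starD op_starZ op_starM op_starK.

Lemma ip_star (T : adjointable) v w : ip (T v) w = ip v (op_fun (star T) w).
Proof. exact: adjointP. Qed.

Lemma op_starE (T : adjointable) T' : has_adjoint T T' ->
  forall v, op_fun (star T) v = T' v.
Proof. exact: op_star_eq. Qed.

Lemma op_sumE (I : Type) (r : seq I) (P : pred I) (F : I -> adjointable) v :
  op_fun (\sum_(i <- r | P i) F i) v = \sum_(i <- r | P i) F i v.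
Proof. exact: (big_morph (fun T : adjointable => T v)). Qed.

Definition bounded_op (T : adjointable) (M : R) :=
  0 <= M /\ forall v, hnorm (T v) <= M * hnorm v.

(** If s is the norm of [star T v], then s^2 = <T (star T v), v> <= M s |v|. *)
Lemma bounded_star T M : bounded_op T M -> bounded_op (star T) M.
Proof.
move=> [M0 h]; split=> // v.
have [->|s0] := eqVneq (hnorm (op_fun (star T) v)) 0; first by rewrite mulr_ge0 ?hnorm_ge0.
have s_gt0 : 0 < hnorm (op_fun (star T) v) by rewrite lt_neqAle eq_sym s0 hnorm_ge0.
rewrite -(ler_pM2r s_gt0) -expr2.
have -> : hnorm (op_fun (star T) v) ^+ 2 = Normc.normc (ip (T (op_fun (star T) v)) v).
  by rewrite ip_star -hnorm_sqr normc_real ger0_norm // sqr_ge0.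
apply: le_trans (cauchy_schwarz _ _) _; rewrite mulrAC.
by rewrite ler_wpM2r ?hnorm_ge0 ?h.
Qed.

Definition opnorm (T : adjointable) : R :=
  sup [set hnorm (T v) | v in [set v | hnorm v <= 1]].

Lemma opnorm_le (T : adjointable) (M : R) :
  (forall v, hnorm v <= 1 -> hnorm (T v) <= M) -> opnorm T <= M.
Proof.
move=> h; apply: ge_sup; last by move=> _ [v /= v1 <-]; exact: h.
by exists (hnorm (T 0)), 0; rewrite //= hnorm0.
Qed.

Lemma opnorm_ge (T : adjointable) (M : R) v : bounded_op T M -> hnorm v <= 1 ->
  hnorm (T v) <= opnorm T.
Proof.
move=> [M0 h] v1; apply: sup_upper_bound; last by exists v.
split; first by exists (hnorm (T v)), v.
exists M => _ [w /= w1 <-]; apply: le_trans (h w) _.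
by rewrite -[leRHS]mulr1 ler_wpM2l.
Qed.

Lemma op0 (T : adjointable) : T 0 = 0.
Proof. by rewrite -[in LHS](scale0r (0 : H)) opZ scale0r. Qed.

Lemma opnorm_ge0 T (M : R) : bounded_op T M -> 0 <= opnorm T.
Proof.
by move=> h; have := opnorm_ge h (v := 0); rewrite op0 hnorm0; exact.
Qed.

Lemma opnormP (T : adjointable) (M : R) v : bounded_op T M ->
  hnorm (T v) <= opnorm T * hnorm v.
Proof.
move=> h; have [v0|v0] := eqVneq (hnorm v) 0.
  by rewrite (hnorm_eq0 v0) op0 hnorm0 mulr0.
have v_gt0 : 0 < hnorm v by rewrite lt_neqAle eq_sym v0 hnorm_ge0.
have nv : Normc.normc ((hnorm v)^-1)%:C = (hnorm v)^-1.
  by rewrite normc_real ger0_norm // invr_ge0 hnorm_ge0.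
have := opnorm_ge h (v := ((hnorm v)^-1)%:C *: v).
rewrite opZ !hnormZ nv mulVf // => /(_ (lexx _)).
by rewrite mulrC ler_pdivrMr.
Qed.

End Adjointable.

Section RepresentationSeminorm.
Variables (R : realType) (A : starAlgType R[i]) (H : preHilbert R).
Variable f : A -> adjointable H.
Hypothesis hf : star_hom f.
Hypothesis fbd : forall a, exists M, bounded_op (f a) M.

Let fM : forall a b, f (a * b) = f a * f b. Proof. by case: hf. Qed.
Let fS : forall a, f (star a) = star (f a). Proof. by case: hf. Qed.

Definition rep_norm a := opnorm (f a).

Let le a v : hnorm (f a v) <= rep_norm a * hnorm v.
Proof. by have [M hM] := fbd a; exact: opnormP hM. Qed.

Let ge0 a : 0 <= rep_norm a.
Proof. by have [M hM] := fbd a; exact: opnorm_ge0 hM. Qed.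

Let le1 a v : hnorm v <= 1 -> hnorm (f a v) <= rep_norm a.
Proof.
by move=> v1; apply: le_trans (le a v) _; rewrite -[leRHS]mulr1 ler_wpM2l.
Qed.

Fact rep_norm_leD a b : rep_norm (a + b) <= rep_norm a + rep_norm b.
Proof.
apply: opnorm_le => v v1; rewrite (_ : f (a + b) = f a + f b); last by case: hf.
by apply: le_trans (hnorm_leD _ _) _; apply: lerD; exact: le1.
Qed.

Fact rep_normZ c a : rep_norm (c *: a) = Normc.normc c * rep_norm a.
Proof.
have fZ x : f (c *: x) = c *: f x by case: hf.
have n0 := normc_ge0 c.
apply/eqP; rewrite eq_le; apply/andP; split.
  by apply: opnorm_le => v v1; rewrite fZ hnormZ ler_wpM2l ?le1.
have [->|c0] := eqVneq c 0; first by rewrite Normc.normc0 mul0r ge0.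
have cn : 0 < Normc.normc c.
  rewrite lt_neqAle n0 andbT eq_sym.
  by apply: contra_neq c0; exact: Normc.eq0_normc.
rewrite mulrC -ler_pdivlMr //; apply: opnorm_le => v v1.
by rewrite ler_pdivlMr // mulrC -hnormZ; have := le1 (c *: a) v1; rewrite fZ.
Qed.

Fact rep_norm_leM a b : rep_norm (a * b) <= rep_norm a * rep_norm b.
Proof.
apply: opnorm_le => v v1; rewrite fM; apply: le_trans (le _ _) _.
by rewrite ler_wpM2l ?le1.
Qed.

(** The point is |T v|^2 = <star T T v, v>, which bounds |T|^2 by |star T T|. *)
Fact rep_norm_star_mul a : rep_norm (star a * a) = rep_norm a ^+ 2.
Proof.
have le_star : rep_norm (star a) <= rep_norm a.
  apply: opnorm_le => v v1.
  have [_ h] : bounded_op (f (star a)) (rep_norm a).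
    by rewrite fS; apply: bounded_star; split=> // w; exact: le.
  by apply: le_trans (h v) _; rewrite -[leRHS]mulr1 ler_wpM2l.
apply/eqP; rewrite eq_le; apply/andP; split.
  by rewrite expr2; apply: le_trans (rep_norm_leM _ _) _; rewrite ler_wpM2r.
rewrite -[leRHS]sqr_sqrtr // ler_pXn2r ?nnegrE ?sqrtr_ge0 //.
apply: opnorm_le => v v1.
rewrite -[leLHS]ger0_norm ?hnorm_ge0 // -sqrtr_sqr ler_sqrt //.
have -> : hnorm (f a v) ^+ 2 = Normc.normc (ip (f (star a * a) v) v).
  rewrite fM fS -[ip _ v]/(ip (op_fun (star (f a)) (f a v)) v) ip_star starK.
  by rewrite -hnorm_sqr normc_real ger0_norm // sqr_ge0.
apply: le_trans (cauchy_schwarz _ _) _; rewrite -[leRHS]mulr1.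
by apply: ler_pM; rewrite ?hnorm_ge0 ?le1.
Qed.

Fact rep_norm1_neq0 : rep_norm 1 != 0.
Proof.
apply/eqP => h; have [v /eqP] := ph_nontrivial H; apply; apply: hnorm_eq0.
apply/eqP; rewrite eq_le hnorm_ge0 andbT; have := le 1 v.
by rewrite h (_ : f 1 = 1) ?mul0r //; case: hf.
Qed.

Definition rep_csn : cstar_seminorm A := CStarSeminorm
  rep_norm_leD rep_normZ rep_norm_leM rep_norm_star_mul rep_norm1_neq0.

Lemma rep_csn_eq0 a : rep_csn a = 0 -> f a = 0.
Proof.
move=> h; apply: op_ext => v; apply: hnorm_eq0.
apply/eqP; rewrite eq_le hnorm_ge0 andbT; have [M hM] := fbd a.
by have := opnormP v hM; rewrite [opnorm _]h mul0r.
Qed.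

End RepresentationSeminorm.

(** * Finitely supported functions on the cone *)

(** The relation sum_i z_i z_i^* = 1 gives sum_i |z_i^* v|^2 = |v|^2, so the
    generators act as contractions in any representation by adjointable
    operators. *)
Lemma sphere_rep_bounded (R : realType) (n : nat) (q : R) (H : preHilbert R)
    (f : qsphere n q -> adjointable H) : star_hom f ->
  forall a, exists M, bounded_op (f a) M.
Proof.
move=> hf a; have [fD fZ f1 fM fS] := hf; have [x ->] := qsphere_exprP a.
elim: x => /= [i|||x [M [M0 hM]] y [M' [M'0 hM']]|x [M [M0 hM]]|
  x [M [M0 hM]] y [M' [M'0 hM']]|c x [M [M0 hM]]|x [M hM]].
- exists 1; rewrite -[f _]starK -fS; apply: bounded_star; split=> // v.
  rewrite mul1r; apply: hnorm_sqr_le.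
  have [_ _ _ hd] := qsphere_zP n q.
  have -> : ip v v = ip (op_fun (f 1) v) v by rewrite f1.
  rewrite -hd (star_hom_sum hf) op_sumE ip_suml.
  have e j : ip (op_fun (f (qsphere_z q j * star (qsphere_z q j))) v) v =
      ip (f (star (qsphere_z q j)) v) (f (star (qsphere_z q j)) v).
    rewrite fM fS; set T := f _.
    by rewrite -[ip _ v]/(ip (T (op_fun (star T) v)) v) ip_star.
  rewrite (eq_bigr _ (fun j _ => e j)) (bigD1 i) //= lerDl.
  by apply: sumr_ge0 => j _; exact: ip_ge0.
- exists 0; split=> // v; rewrite (star_hom0 hf) mul0r.
  by rewrite -[op_fun 0 v]/(0 : H) hnorm0.
- exists 1; split=> // v; rewrite f1 mul1r; exact: lexx.
- exists (M + M'); split; first exact: addr_ge0.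
  move=> v; rewrite fD mulrDl; apply: le_trans (hnorm_leD _ _) _.
  exact: lerD.
- exists M; split=> // v; rewrite -scaleN1r fZ [op_fun _ v]/(-1 *: f _ v).
  by rewrite hnormZ normcN Normc.normc1 mul1r.
- exists (M * M'); split; first exact: mulr_ge0.
  move=> v; rewrite fM; apply: le_trans (hM _) _.
  by rewrite -mulrA ler_wpM2l.
- have n0 := normc_ge0 c.
  exists (Normc.normc c * M); split; first exact: mulr_ge0.
  by move=> v; rewrite fZ hnormZ -mulrA ler_wpM2l.
- by exists M; rewrite fS; exact: bounded_star.
Qed.

Section FinitelySupported.
Variables (R : realType) (n : nat).

Definition lattice : Type := {ffun 'I_n.+1 -> int}.
HB.instance Definition _ := GRing.Zmodule.on lattice.

(** The cone N^n x Z inside Z^(n+1): the last coordinate may be negative. *)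
Definition cone (y : lattice) := forall i : 'I_n.+1, (i < n)%N -> 0 <= y i.

(** Functions on the whole group Z^(n+1) that vanish off the cone: shifts are then
    bijections of the index set, and no truncated subtraction is needed. *)
Definition cone_finsupp (f : lattice -> R[i]) : Prop :=
  finite_set [set y | f y != 0] /\ forall y, f y != 0 -> cone y.

Definition hvec : Type := {f : lattice -> R[i] | cone_finsupp f}.
HB.instance Definition _ := gen_eqMixin hvec.
HB.instance Definition _ := gen_choiceMixin hvec.

Definition hfun (f : hvec) : lattice -> R[i] := sval f.
Coercion hfun : hvec >-> Funclass.

Lemma hvec_ext (f g : hvec) : f =1 g -> f = g.
Proof.
move: f g => [f hf] [g hg] /= /funext fg; case: _ / fg hg => hg.
by congr exist.
Qed.

Lemma hvec_cone (f : hvec) y : ~ cone y -> f y = 0.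
Proof.
move=> hy; have [_ h] := svalP f; apply: contrapT => /eqP fy.
exact: hy (h _ fy).
Qed.

Lemma hvec_finite (f : hvec) : finite_set [set y | f y != 0].
Proof. by have [] := svalP f. Qed.

Fact cone_finsupp0 : cone_finsupp (fun=> 0).
Proof.
split=> [|y]; last by rewrite eqxx.
by apply: (sub_finite_set _ (finite_set0 lattice)) => y /=; rewrite eqxx.
Qed.

Fact cone_finsuppD (f g : hvec) : cone_finsupp (fun y => f y + g y).
Proof.
split=> [|y].
  apply: (sub_finite_set (B := [set y | f y != 0] `|` [set y | g y != 0])).
    move=> y /=; apply: contraNP => /not_orP[/negP/negPn/eqP-> /negP/negPn/eqP->].
    by rewrite addr0.
  by rewrite finite_setU; split; exact: hvec_finite.
by apply: contraNP => hy; rewrite !hvec_cone // addr0.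
Qed.

Fact cone_finsuppZ a (f : hvec) : cone_finsupp (fun y => a * f y).
Proof.
split=> [|y]; last by apply: contraNP => hy; rewrite hvec_cone // mulr0.
apply: sub_finite_set (hvec_finite f) => y /=.
by apply: contraNneq => ->; rewrite mulr0.
Qed.

Definition hvec0 : hvec := exist _ _ cone_finsupp0.
Definition hvec_add (f g : hvec) : hvec := exist _ _ (cone_finsuppD f g).
Definition hvec_scale a (f : hvec) : hvec := exist _ _ (cone_finsuppZ a f).

Fact hvec_addA : associative hvec_add.
Proof. by move=> f g h; apply: hvec_ext => y; exact: addrA. Qed.
Fact hvec_addC : commutative hvec_add.
Proof. by move=> f g; apply: hvec_ext => y; exact: addrC. Qed.
Fact hvec_add0 : left_id hvec0 hvec_add.
Proof. by move=> f; apply: hvec_ext => y; exact: add0r. Qed.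
Fact hvec_addN : left_inverse hvec0 (hvec_scale (-1)) hvec_add.
Proof. by move=> f; apply: hvec_ext => y; rewrite /= mulN1r addNr. Qed.

HB.instance Definition _ :=
  GRing.isZmodule.Build hvec hvec_addA hvec_addC hvec_add0 hvec_addN.

Fact hvec_scaleA a b f : hvec_scale a (hvec_scale b f) = hvec_scale (a * b) f.
Proof. by apply: hvec_ext => y; exact: mulrA. Qed.
Fact hvec_scale1 : left_id 1 hvec_scale.
Proof. by move=> f; apply: hvec_ext => y; exact: mul1r. Qed.
Fact hvec_scaleDr : right_distributive hvec_scale +%R.
Proof. by move=> a f g; apply: hvec_ext => y; exact: mulrDr. Qed.
Fact hvec_scaleDl f : {morph hvec_scale^~ f : a b / a + b}.
Proof. by move=> a b; apply: hvec_ext => y; exact: mulrDl. Qed.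

HB.instance Definition _ := GRing.Zmodule_isLmodule.Build R[i] hvec
  hvec_scaleA hvec_scale1 hvec_scaleDr hvec_scaleDl.

Lemma hvec_sumE (I : Type) (r : seq I) (P : pred I) (F : I -> hvec) y :
  hfun (\sum_(i <- r | P i) F i) y = \sum_(i <- r | P i) F i y.
Proof. exact: (big_morph (fun f : hvec => f y)). Qed.

Definition hip (f g : hvec) : R[i] :=
  \sum_(y \in [set: lattice]) f y * Num.conj (g y).

Lemma hipE (f g : hvec) (P : set lattice) : finite_set P ->
  [set y | f y != 0] `<=` P ->
  hip f g = \sum_(y <- fset_set P) f y * Num.conj (g y).
Proof.
move=> finP fP; rewrite -fsbig_finite //; apply/esym/fsbig_widen => // y [_ /= nPy].
by have [->|/fP //] := eqVneq (f y) 0; rewrite mul0r.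
Qed.

Fact hipDl (f g h : hvec) : hip (f + g) h = hip f h + hip g h.
Proof.
have fU : finite_set ([set y | f y != 0] `|` [set y | g y != 0]).
  by rewrite finite_setU; split; exact: hvec_finite.
rewrite !(hipE _ fU) -?big_split /=; [|by move=> y; right|by move=> y; left|].
  by apply: eq_bigr => y _; rewrite -mulrDl.
move=> y /=; apply: contraNP => /not_orP[/negP/negPn/eqP-> /negP/negPn/eqP->].
by rewrite addr0.
Qed.

Fact hipZl a (f g : hvec) : hip (a *: f) g = a * hip f g.
Proof.
rewrite !(hipE _ (hvec_finite f)) // ?big_distrr /=.
  by apply: eq_bigr => y _; rewrite -mulrA.
by move=> y /=; apply: contraNneq => ->; rewrite mulr0.
Qed.

Fact hip_conj f g : hip g f = Num.conj (hip f g).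
Proof.
have fU : finite_set ([set y | f y != 0] `|` [set y | g y != 0]).
  by rewrite finite_setU; split; exact: hvec_finite.
rewrite !(hipE _ fU) ?rmorph_sum /=; [|by move=> y; left|by move=> y; right].
by apply: eq_bigr => y _; rewrite rmorphM /= conjCK mulrC.
Qed.

Fact hip_ge0 f : 0 <= hip f f.
Proof.
rewrite (hipE _ (hvec_finite f)) //; apply: sumr_ge0 => y _.
by rewrite -normCK exprn_ge0.
Qed.

Fact hip_eq0 (f : hvec) : hip f f = 0 -> f = 0.
Proof.
move=> /eqP; rewrite (hipE _ (hvec_finite f)) // psumr_eq0; last first.
  by move=> y _; rewrite -normCK exprn_ge0.
move=> /allP h; apply: hvec_ext => y; apply: contrapT => /eqP fy.
have := h y; rewrite in_fset_set; last exact: hvec_finite.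
rewrite mem_set // => /(_ isT) /=.
by rewrite mulf_eq0 conjC_eq0 orbb (negPf fy).
Qed.

Fact delta_finsupp x : cone x -> cone_finsupp (fun y => (y == x)%:R).
Proof.
move=> cx; split=> [|y].
  apply: (sub_finite_set (B := [set x])) => // y /=.
  by case: (eqVneq y x) => // _; rewrite mulr0n eqxx.
by case: (eqVneq y x) => [->|_] //; rewrite mulr0n eqxx.
Qed.

Definition hdelta x (cx : cone x) : hvec := exist _ _ (delta_finsupp cx).

Fact hvec_nontrivial : exists f : hvec, f != 0.
Proof.
have c0 : cone 0 by move=> i _; rewrite ffunE.
exists (hdelta c0); apply/eqP => /(congr1 (fun f : hvec => f 0)) /eqP.
by rewrite /= eqxx oner_eq0.
Qed.

Definition hspace : preHilbert R :=
  PreHilbert hipDl hipZl hip_conj hip_ge0 hip_eq0 hvec_nontrivial.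

End FinitelySupported.

(** * The representation of the quantum sphere by weighted shifts *)

Section SphereRepresentation.
Variables (R : realType) (n : nat) (q : R).
Hypotheses (hq0 : 0 < q) (hq1 : q < 1).
Local Notation X := (lattice n).
Local Notation V := (hspace R n).

Definition unit_vec (i : 'I_n.+1) : X := [ffun j => ((j == i) : nat)%:Z].
Local Notation e := unit_vec.

Lemma unit_vecE i j : e i j = ((j == i) : nat)%:Z.
Proof. by rewrite ffunE. Qed.

(** [tau k] is the eigenvalue of [x_k = sum_(j >= k) z_j z_j^*]. With the value 0
    for k = n+1, the relation [z_i z_i^* = x_i - x_(i+1)] and the weight [wt i]
    take the same form for i = n as for i < n. *)
Definition tau (k : nat) (y : X) : R :=
  if (k <= n)%N then (q ^+ 2) ^ (\sum_(j < n.+1 | (j < k)%N) y j) else 0.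

(** The weight of the arrow that enters y in direction i; for i < n it vanishes at
    y_i = 0, where this arrow would come from outside the cone. *)
Definition wt (i : 'I_n.+1) (y : X) : R := Num.sqrt (tau i y - tau i.+1 y).

Let q2_gt0 : 0 < q ^+ 2. Proof. exact: exprn_gt0. Qed.
Let q2_lt1 : q ^+ 2 < 1. Proof. by rewrite expr_lt1 // ltW. Qed.
Let q2_neq0 : q ^+ 2 != 0. Proof. by rewrite gt_eqF. Qed.

Lemma tau_ge0 k y : 0 <= tau k y.
Proof. by rewrite /tau; case: ifP => // _; rewrite exprz_ge0 // ltW. Qed.

Lemma tau_gt0 k y : (k <= n)%N -> 0 < tau k y.
Proof. by rewrite /tau => ->; rewrite exprz_gt0. Qed.

Lemma tau0 y : tau 0 y = 1.
Proof. by rewrite /tau leq0n big_pred0 // expr0z. Qed.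

Lemma tau_max y : tau n.+1 y = 0.
Proof. by rewrite /tau ltnn. Qed.

Lemma tauD k (y y' : X) : (k <= n)%N -> tau k (y + y') = tau k y * tau k y'.
Proof.
move=> kn; rewrite /tau kn -expfzDr //; congr (_ ^ _).
by rewrite -big_split; apply: eq_bigr => j _; rewrite ffunE.
Qed.

Lemma tau_shift k y i :
  tau k (y + e i) = (if (i < k)%N then q ^+ 2 else 1) * tau k y.
Proof.
have [kn|nk] := leqP k n; last by rewrite /tau leqNgt nk mulr0.
rewrite tauD // mulrC; congr (_ * _); rewrite /tau kn.
under eq_bigr do rewrite unit_vecE.
case: (boolP (i < k)%N) => ik.
  by rewrite (bigD1 i) //= eqxx big1 ?addr0 ?expr1z // => j /andP[_ /negPf->].
by rewrite big1 ?expr0z // => j jk; case: eqVneq => // ji; rewrite -ji jk in ik.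
Qed.

Lemma tauS (i : 'I_n.+1) y : (i < n)%N -> tau i.+1 y = (q ^+ 2) ^ (y i) * tau i y.
Proof.
move=> i_n; rewrite /tau i_n (ltnW i_n) -expfzDr //; congr (_ ^ _).
rewrite (bigD1 i) //=; congr (_ + _); apply: eq_bigl => j.
by rewrite ltnS ltn_neqAle andbC.
Qed.

Lemma wt_sqr i y : cone y -> wt i y ^+ 2 = tau i y - tau i.+1 y.
Proof.
move=> cy; rewrite sqr_sqrtr // subr_ge0.
have [i_n|ni] := ltnP i n; last by rewrite {1}/tau ltnNge ni /= tau_ge0.
rewrite tauS // -[leRHS]mul1r ler_wpM2r ?tau_ge0 //.
case: (y i) (cy _ i_n) => // m _.
by rewrite -exprnP exprn_ile1 // ltW.
Qed.

Lemma wt_shift_lt (i j : 'I_n.+1) y : (i < j)%N -> wt j (y + e i) = q * wt j y.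
Proof.
move=> ij; rewrite /wt !tau_shift ij ltnS (ltnW ij) -mulrBr sqrtrM ?ltW //.
by rewrite sqrtr_sqr ger0_norm // ltW.
Qed.

Lemma wt_shift_gt (i j : 'I_n.+1) y : (j < i)%N -> wt j (y + e i) = wt j y.
Proof.
by move=> ji; rewrite /wt !tau_shift ltnS [(i <= j)%N]leqNgt ji (leq_gtF (ltnW ji)) !mul1r.
Qed.

Lemma wt_eq0 (i : 'I_n.+1) (y : X) : (i < n)%N -> y i = 0 -> wt i y = 0.
Proof. by move=> i_n y0; rewrite /wt tauS // y0 expr0z mul1r subrr sqrtr0. Qed.

Lemma wt_gt0 (i : 'I_n.+1) (y : X) : cone y -> ((i < n)%N -> 0 < y i) -> 0 < wt i y.
Proof.
move=> cy yi; rewrite lt_neqAle sqrtr_ge0 andbT eq_sym -sqrf_eq0 wt_sqr // subr_eq0.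
have [i_n|ni] := ltnP i n; last first.
  rewrite gt_eqF // {1}/tau ltnNge ni /= tau_gt0 //.
  by rewrite -ltnS.
rewrite gt_eqF // tauS // -[ltRHS]mul1r ltr_pM2r ?tau_gt0 1?ltnW //.
case: (y i) (yi i_n) => // -[//|m] _.
by rewrite -exprnP exprn_ilt1 // ltW.
Qed.

Definition create_fun i (f : hvec R n) (y : X) : R[i] := (wt i y)%:C * f (y - e i).
Definition annih_fun i (f : hvec R n) (y : X) : R[i] :=
  (wt i (y + e i))%:C * f (y + e i).

Fact create_finsupp i f : cone_finsupp (create_fun i f).
Proof.
split=> [|y].
  apply: (sub_finite_set (B := (fun y => y + e i) @` [set y | f y != 0])).
    move=> y /=; rewrite /create_fun => h; exists (y - e i); last exact: subrK.
    by apply: contraNneq h => ->; rewrite mulr0.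
  exact/finite_image/hvec_finite.
apply: contraNP => cy; rewrite /create_fun hvec_cone ?mulr0 // => h; apply: cy => j jn.
have := h j jn; rewrite !ffunE => h'; apply: le_trans h' _.
by rewrite gerBl; case: (_ == _).
Qed.

Fact annih_finsupp i f : cone_finsupp (annih_fun i f).
Proof.
split=> [|y].
  apply: (sub_finite_set (B := (fun y => y - e i) @` [set y | f y != 0])).
    move=> y /=; rewrite /annih_fun => h; exists (y + e i); last exact: addrK.
    by apply: contraNneq h => ->; rewrite mulr0.
  exact/finite_image/hvec_finite.
apply: contraNP => cy; rewrite /annih_fun.
have [c1|c1] := pselect (cone (y + e i)); last by rewrite hvec_cone ?mulr0.
rewrite wt_eq0 ?mul0r //.
  have [//|ni] := ltnP i n; case: cy => j jn; have := c1 j jn.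
  rewrite !ffunE; case: (eqVneq j i) => [ji|_]; last by rewrite addr0.
  by rewrite -ji leqNgt jn in ni.
have [j jn yj] : exists2 j : 'I_n.+1, (j < n)%N & y j < 0.
  apply: contrapT => h; apply: cy => j jn; rewrite leNgt; apply/negP => yj.
  by apply: h; exists j.
have := c1 j jn; rewrite !ffunE; case: (eqVneq j i) => [<-|_].
  by rewrite eqxx => h; apply/eqP; rewrite eq_le h andbT lezD1.
by rewrite addr0 leNgt yj.
Qed.

Definition create i f : hvec R n := exist _ _ (create_finsupp i f).
Definition annih i f : hvec R n := exist _ _ (annih_finsupp i f).

Fact create_adjoint i : @has_adjoint R V (create i) (annih i).
Proof.
move=> f g; rewrite /= /hip (reindex_fsbigT (fun y => y + e i)); last first.
  by exists (fun y => y - e i) => y; [exact: addrK|exact: subrK].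
apply: eq_fsbigr => y _ /=; rewrite /create_fun /annih_fun addrK rmorphM /=.
by rewrite [Num.conj (_%:C)]conjc_real mulrCA mulrA.
Qed.

Definition zop i : adjointable V := mk_op (create_adjoint i).

Lemma star_zopE i (f : hvec R n) : op_fun (star (zop i)) f = annih i f.
Proof. exact: (@op_starE _ _ (zop i) (annih i) (create_adjoint i) f). Qed.

Lemma zop_star_zop i (f : hvec R n) y :
  hfun (op_fun (zop i * star (zop i)) f) y = (tau i y - tau i.+1 y)%:C * f y.
Proof.
rewrite -[hfun _ y]/(create_fun i (op_fun (star (zop i)) f) y) star_zopE.
rewrite /create_fun [annih _ _ _]/(annih_fun i f (y - e i)) /annih_fun subrK.
have [cy|cy] := pselect (cone y); last by rewrite hvec_cone // !mulr0.
by rewrite mulrA -rmorphM -expr2 wt_sqr.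
Qed.

Lemma star_zop_zop i (f : hvec R n) y :
  hfun (op_fun (star (zop i) * zop i) f) y =
  (tau i y - q ^+ 2 * tau i.+1 y)%:C * f y.
Proof.
rewrite -[hfun _ y]/(hfun (op_fun (star (zop i)) (create i f)) y) star_zopE.
rewrite [annih _ _ _]/(annih_fun i (create i f) y) /annih_fun.
rewrite [create _ _ _]/(create_fun i f (y + e i)) /create_fun addrK.
have [cy|cy] := pselect (cone y); last by rewrite hvec_cone // !mulr0.
rewrite mulrA -rmorphM -expr2 wt_sqr ?tau_shift ?ltnn ?mul1r ?ltnS ?leqnn //.
by move=> j jn; rewrite !ffunE addr_ge0 ?cy.
Qed.

(** The sum telescopes down to tau_k - tau_(n+1) = tau_k. *)
Lemma tail_zop k (f : hvec R n) y : (k <= n.+1)%N ->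
  hfun (op_fun (\sum_(j < n.+1 | (k <= j)%N) zop j * star (zop j)) f) y =
  (tau k y)%:C * f y.
Proof.
move=> kn; rewrite op_sumE hvec_sumE.
under eq_bigr do rewrite zop_star_zop.
rewrite -big_distrl -raddf_sum /=; congr (_%:C * _).
have := telescope_sumr (fun j => - tau j y) kn.
rewrite tau_max oppr0 sub0r opprK => <-.
rewrite big_geq_mkord; apply: eq_bigr => j _.
by rewrite opprK addrC.
Qed.

Lemma zop_relations :
  [/\ forall i j : 'I_n.+1, (i < j)%N -> zop j * zop i = q%:C *: (zop i * zop j),
      forall i j, i != j -> star (zop i) * zop j = q%:C *: (zop j * star (zop i)),
      forall i, star (zop i) * zop i = zop i * star (zop i) +
        (1 - q ^+ 2)%:C *: \sum_(j < n.+1 | (i < j)%N) zop j * star (zop j) &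
      \sum_(i < n.+1) zop i * star (zop i) = 1].
Proof.
split.
- move=> i j ij; apply: op_ext => f; apply: hvec_ext => y.
  rewrite -[LHS]/(create_fun j (create i f) y).
  rewrite -[RHS]/(q%:C * create_fun i (create j f) y).
  rewrite /create_fun /= /create_fun.
  have -> : wt j y = q * wt j (y - e i) by rewrite -(@wt_shift_lt i j _ ij) subrK.
  rewrite -[wt i (y - e j)](@wt_shift_gt j) // subrK rmorphM /=.
  have -> : y - e j - e i = y - e i - e j by rewrite addrAC.
  by rewrite !mulrA; congr (_ * _); rewrite -!mulrA [X in _ * X]mulrC.
- move=> i j ij; apply: op_ext => f; apply: hvec_ext => y.
  rewrite -[LHS]/(hfun (op_fun (star (zop i)) (create j f)) y) star_zopE.
  rewrite -[RHS]/(q%:C * create_fun j (op_fun (star (zop i)) f) y) star_zopE.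
  rewrite /create_fun /= /annih_fun /= /create_fun.
  have -> : y - e j + e i = y + e i - e j by rewrite addrAC.
  rewrite !mulrA -!rmorphM /=; congr (_%:C * _).
  have [ilj|jli|/val_inj ije] := ltngtP i j; last by rewrite ije eqxx in ij.
  + rewrite (@wt_shift_lt i j _ ilj) -[wt i (y + e i - e j)](@wt_shift_gt j) // subrK.
    by rewrite mulrC.
  + have -> : wt i (y + e i) = q * wt i (y + e i - e j).
      by rewrite -(@wt_shift_lt j i _ jli) subrK.
    by rewrite (@wt_shift_gt i j _ jli) mulrAC.
- move=> i; apply: op_ext => f; apply: hvec_ext => y.
  rewrite star_zop_zop.
  rewrite -[RHS]/(hfun (op_fun (zop i * star (zop i)) f) y + (1 - q ^+ 2)%:C *
    hfun (op_fun (\sum_(j < n.+1 | (i < j)%N) zop j * star (zop j)) f) y).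
  rewrite zop_star_zop tail_zop // mulrA -rmorphM -mulrDl -rmorphD; congr (_%:C * _).
  by ring.
- apply: op_ext => f; apply: hvec_ext => y.
  rewrite (eq_bigl (fun j : 'I_n.+1 => (0 <= j)%N)) // tail_zop // tau0.
  by rewrite rmorph1 mul1r.
Qed.

Lemma sphere_rep : exists f : qsphere n q -> adjointable V,
  star_hom f /\ forall i, f (qsphere_z q i) = zop i.
Proof. by have [f [hf _]] := qsphere_univ zop_relations; exists f. Qed.

End SphereRepresentation.

(** * A spanning set of the quantum sphere *)

Section QCommute.
Variables (K : fieldType) (A : algType K).
Implicit Types a b : A.

(** Reordering a product of generators costs powers of q, and a span does not
    see nonzero scalars; so it is enough to follow products up to such scalars. *)
Definition proportional a b := exists2 c : K, c != 0 & a = c *: b.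

Lemma proportional_refl a : proportional a a.
Proof. by exists 1; rewrite ?oner_neq0 ?scale1r. Qed.

Lemma proportional_sym a b : proportional a b -> proportional b a.
Proof.
move=> [c c0 ->]; exists c^-1; first by rewrite invr_eq0.
by rewrite scalerA mulVf // scale1r.
Qed.

Lemma proportional_trans b a a' :
  proportional a b -> proportional b a' -> proportional a a'.
Proof.
move=> [c c0 ->] [d d0 ->]; exists (c * d); first by rewrite mulf_neq0.
by rewrite scalerA.
Qed.

Lemma proportionalMl a b b' : proportional b b' -> proportional (a * b) (a * b').
Proof. by move=> [c c0 ->]; exists c; rewrite // scalerAr. Qed.

Lemma proportionalMr a b b' : proportional b b' -> proportional (b * a) (b' * a).
Proof. by move=> [c c0 ->]; exists c; rewrite // scalerAl. Qed.

Definition qcomm a b := proportional (a * b) (b * a).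

Lemma qcomm_sym a b : qcomm a b -> qcomm b a.
Proof. exact: proportional_sym. Qed.

Lemma qcommM a b b' : qcomm a b -> qcomm a b' -> qcomm a (b * b').
Proof.
move=> h h'; apply: (@proportional_trans (b * a * b')).
  by rewrite mulrA; exact: proportionalMr.
by rewrite -!mulrA; exact: proportionalMl.
Qed.

Lemma qcomm1 a : qcomm a 1.
Proof. by rewrite /qcomm mulr1 mul1r; exact: proportional_refl. Qed.

Lemma qcommX a b k : qcomm a b -> qcomm a (b ^+ k).
Proof.
by move=> h; elim: k => [|k IH]; [exact: qcomm1|rewrite exprS; exact: qcommM].
Qed.

Lemma qcomm_prod (I : Type) (r : seq I) (P : pred I) (F : I -> A) a :
  (forall i, P i -> qcomm a (F i)) -> qcomm a (\prod_(i <- r | P i) F i).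
Proof. by move=> h; apply: big_ind => //; [exact: qcomm1|exact: qcommM]. Qed.

(** Moving a to the right past the factors before the i-th costs scalars only. *)
Lemma qcomm_into_prod (I : eqType) (r : seq I) (F : I -> A) a i :
  uniq r -> i \in r -> (forall j, j != i -> qcomm a (F j)) ->
  proportional (a * \prod_(j <- r) F j)
    (\prod_(j <- r) (if j == i then a * F j else F j)).
Proof.
move=> + + aF; elim: r => // k r IH /= /andP[kr ur].
rewrite inE !big_cons; have [->|ik] := eqVneq i k => /= ir.
  rewrite mulrA (eq_big_seq F); first exact: proportional_refl.
  by move=> j jr; case: eqVneq => // jk; rewrite -jk jr in kr.
apply: (@proportional_trans (F k * (a * \prod_(j <- r) F j))).
  by rewrite !mulrA; apply/proportionalMr/aF; rewrite eq_sym.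
exact/proportionalMl/IH.
Qed.

Lemma qcomm_into_finprod (I : finType) (F : I -> A) a i :
  (forall j, j != i -> qcomm a (F j)) ->
  proportional (a * \prod_j F j) (\prod_j (if j == i then a * F j else F j)).
Proof. by apply: qcomm_into_prod; rewrite ?index_enum_uniq ?mem_index_enum. Qed.

End QCommute.

Section Span.
Variables (K : fieldType) (A : algType K) (I : Type) (S : I -> A).

Definition in_span (a : A) :=
  exists s : seq (K * I), a = \sum_(t <- s) t.1 *: S t.2.

Lemma in_span0 : in_span 0.
Proof. by exists [::]; rewrite big_nil. Qed.

Lemma in_spanS i : in_span (S i).
Proof. by exists [:: (1, i)]; rewrite big_seq1 scale1r. Qed.

Lemma in_spanD a b : in_span a -> in_span b -> in_span (a + b).
Proof. by move=> [s ->] [t ->]; exists (s ++ t); rewrite big_cat. Qed.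

Lemma in_spanZ c a : in_span a -> in_span (c *: a).
Proof.
move=> [s ->]; exists [seq (c * t.1, t.2) | t <- s].
by rewrite big_map scaler_sumr; apply: eq_bigr => t _; rewrite scalerA.
Qed.

Lemma in_span_proportional a b : proportional a b -> in_span b -> in_span a.
Proof. by move=> [c _ ->]; exact: in_spanZ. Qed.

Lemma in_spanM a : (forall i, in_span (a * S i)) ->
  forall b, in_span b -> in_span (a * b).
Proof.
move=> h _ [s ->]; rewrite mulr_sumr; apply: big_ind => [||t _].
- exact: in_span0.
- exact: in_spanD.
- by rewrite -scalerAr; exact: in_spanZ.
Qed.

End Span.

Lemma in_span_uniq (K : fieldType) (A : algType K) (I : eqType) (S : I -> A) a :
  in_span S a -> exists s (c : I -> K), uniq s /\ a = \sum_(i <- s) c i *: S i.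
Proof.
move=> [s ->]; exists (undup (map snd s)), (fun i => \sum_(t <- s | t.2 == i) t.1).
split; first exact: undup_uniq.
under [RHS]eq_bigr do rewrite scaler_suml big_mkcond.
rewrite exchange_big /=; apply: eq_big_seq => t ts.
rewrite (bigD1_seq t.2) /= ?undup_uniq ?mem_undup ?map_f // eqxx.
rewrite big1 ?addr0 // => i it; rewrite eq_sym in it.
by rewrite (negPf it).
Qed.

Section SphereSpan.
Variables (R : realType) (n : nat) (q : R).
Hypothesis q0 : q != 0.
Local Notation A := (qsphere n q).
Local Notation z := (@qsphere_z R n q).
Local Notation x := (@zz_tail R n q).

Let zz (i j : 'I_n.+1) : (i < j)%N -> z j * z i = q%:C *: (z i * z j).
Proof. by have [h _ _ _] := qsphere_zP n q; exact: h. Qed.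
Let sz (i j : 'I_n.+1) : i != j -> star (z i) * z j = q%:C *: (z j * star (z i)).
Proof. by have [_ h _ _] := qsphere_zP n q; exact: h. Qed.

Let qC0 : q%:C != 0 :> R[i].
Proof. by rewrite realC_eq0. Qed.

Lemma qcomm_star (a b : A) : qcomm a b -> qcomm (star b) (star a).
Proof.
move=> [c c0 h]; exists (Num.conj c); first by rewrite conjC_eq0.
by rewrite -!starM -starZ h.
Qed.

Definition letter (s : bool) i : A := if s then z i else star (z i).

Lemma qcomm_letter s t i j : i != j -> qcomm (letter s i) (letter t j).
Proof.
have hzz (k l : 'I_n.+1) : k != l -> qcomm (z k) (z l).
  rewrite neq_ltn => /orP[kl|kl]; [apply: qcomm_sym|]; exists q%:C => //; exact: zz.
have hsz (k l : 'I_n.+1) : k != l -> qcomm (star (z k)) (z l).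
  by move=> kl; exists q%:C => //; exact: sz.
case: s t => [] [] /= ij; first exact: hzz.
- by apply/qcomm_sym/hsz; rewrite eq_sym.
- exact: hsz.
- by apply/qcomm_star/hzz; rewrite eq_sym.
Qed.

Lemma star_tail k : star (x k) = x k.
Proof.
by rewrite /zz_tail star_sum; apply: eq_bigr => j _; rewrite starM starK.
Qed.

(** For i < k the factor q^2 comes out of every term of x_k. For i = k the
    equality combines the two expressions of z_i z_i^* and z_i^* z_i; for k < i
    one adds to x_i the terms z_j z_j^* with k <= j < i, each of which commutes
    with z_i as its factors contribute q and q^-1. *)
Lemma tail_z k i : x k * z i = (if (i < k)%N then (q ^+ 2)%:C else 1) *: (z i * x k).
Proof.
have big (l : nat) : (i < l)%N -> x l * z i = (q ^+ 2)%:C *: (z i * x l).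
  move=> il; rewrite mulr_suml mulr_sumr scaler_sumr; apply: eq_bigr => j lj.
  have ij := leq_trans il lj.
  rewrite -mulrA sz; last by rewrite gt_eqF.
  by rewrite -scalerAr [z j * (_ * _)]mulrA (zz ij) -scalerAl scalerA -rmorphM -expr2 mulrA.
case: ifPn => [ik|]; first exact: big.
rewrite -leqNgt scale1r => ki; rewrite -(subKn ki).
elim: (i - k)%N (leq_subr k i) => [_|m IH mi].
  have xi : x i = z i * star (z i) + x i.+1 by rewrite z_starz subrK.
  rewrite subn0 {1}xi mulrDl big // -mulrA starz_z mulrBr -scalerAr.
  by rewrite subrK.
have mn : (i - m.+1 < n.+1)%N by rewrite ltnS (leq_trans (leq_subr _ _)) // -ltnS.
pose j : 'I_n.+1 := Ordinal mn.
have ji : (j < i)%N by rewrite /= ltn_subrL (leq_trans _ mi).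
have xj : x (i - m.+1) = z j * star (z j) + x (i - m).
  by rewrite z_starz -[in x (i - m)](subnSK mi) /= subrK.
rewrite xj mulrDl mulrDr IH ?(ltnW mi) //; congr (_ + _).
rewrite -mulrA sz; last by rewrite lt_eqF.
by rewrite -scalerAr [z j * (_ * _)]mulrA scalerAl -(zz ji) -mulrA.
Qed.

Lemma qcomm_tail_letter k s i : qcomm (x k) (letter s i).
Proof.
have h : qcomm (x k) (z i).
  exists (if (i < k)%N then (q ^+ 2)%:C else 1); last exact: tail_z.
  by case: ifP => _; rewrite ?oner_neq0 // rmorphXn expf_neq0.
by case: s => //=; rewrite -star_tail; exact/qcomm_sym/qcomm_star.
Qed.

Lemma qcomm_tails k l : qcomm (x k) (x l).
Proof.
exists 1; rewrite ?oner_neq0 // scale1r [x l]/zz_tail mulr_sumr mulr_suml.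
apply: eq_bigr => j _; have h := tail_z k j; have h' := congr1 star h.
move: h'; rewrite starZ !starM star_tail => h'.
rewrite mulrA h -scalerAl -!mulrA; move: h'.
case: ifP => _; last by rewrite conjC1 !scale1r => ->.
by rewrite [Num.conj _]conjc_real => ->; rewrite scalerAr.
Qed.

(** [Negz m] is -(m+1), whence the exponent [m.+1] of the adjoint. *)
Definition zpow i (k : int) : A :=
  match k with Posz m => z i ^+ m | Negz m => star (z i) ^+ m.+1 end.

Definition zmono (d : lattice n) : A := \prod_(i < n.+1) zpow i (d i).

(** Only x_1, ..., x_n occur, since x_0 = 1 and x_(n+1) = 0. *)
Definition xmono (m : {ffun 'I_n -> nat}) : A := \prod_(k < n) x k.+1 ^+ m k.

Definition mono (b : {ffun 'I_n -> nat} * lattice n) : A := xmono b.1 * zmono b.2.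

Lemma qcomm_zpow a i k : qcomm a (z i) -> qcomm a (star (z i)) -> qcomm a (zpow i k).
Proof. by move=> h h'; case: k => m; exact: qcommX. Qed.

(** If s and k have opposite signs the new letter cancels one factor of the power,
    leaving w = z_i z_i^* or w = z_i^* z_i; otherwise it lengthens the power. *)
Lemma letter_zpow s i k : exists w,
  letter s i * zpow i k = w * zpow i (k + (if s then 1 else -1)) /\
  (w = 1 \/ w = letter s i * letter (~~ s) i).
Proof.
case: s k => -[m|m].
- by exists 1; split; [rewrite mul1r addrC -exprS|left].
- exists (letter true i * letter false i); split; last by right.
  rewrite NegzE (_ : - m.+1%:Z + 1 = - m%:Z) ?[zpow _ (- m.+1%:Z)]exprS; last first.
    by rewrite -addn1 PoszD opprD subrK.
  by rewrite -mulrA; case: m => [|m].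
- case: m => [|m]; first by exists 1; split; [rewrite mul1r mulr1|left].
  exists (letter false i * letter true i); split; last by right.
  have -> : m.+1%:Z - 1 = m%:Z by rewrite -addn1 PoszD addrK.
  by rewrite /= exprS mulrA.
- exists 1; split; last by left.
  have -> : Negz m - 1 = Negz m.+1 by rewrite !NegzE -opprD -PoszD addn1.
  by rewrite mul1r /= [RHS]exprS.
Qed.

(** The factor x_k is absorbed into the exponent m, except for x_0 = 1 and
    x_(n+1) = 0. *)
Lemma tail_xmono m k : (k <= n.+1)%N -> forall d,
  in_span mono (xmono m * x k * zmono d).
Proof.
case: k => [|k] kn d.
  by rewrite zz_tail0 mulr1; exact: (in_spanS mono (m, d)).
move: kn; rewrite ltnS leq_eqVlt => /predU1P[->|kn].
  by rewrite zz_tail_max mulr0 mul0r; exact: in_span0.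
pose i := Ordinal kn.
pose m' : {ffun 'I_n -> nat} := [ffun j => ((j == i) + m j)%N].
apply: in_span_proportional (in_spanS mono (m', d)); apply: proportionalMr.
apply: (@proportional_trans _ _ (x k.+1 * xmono m)).
  by apply: qcomm_sym; apply: qcomm_prod => j _; apply: qcommX; exact: qcomm_tails.
apply: proportional_trans (qcomm_into_finprod (i := i) _) _.
  by move=> j _; apply: qcommX; exact: qcomm_tails.
rewrite (eq_bigr (fun j : 'I_n => x j.+1 ^+ m' j)); first exact: proportional_refl.
by move=> j _; rewrite ffunE; case: eqVneq => [->|_] //; rewrite exprD expr1.
Qed.

(** The letter moves through the x's to the power of z_i, where [letter_zpow]
    applies; the resulting w is moved back to the left, and it is a combination of
    x_i and x_(i+1). *)
Lemma letter_mono s i b : in_span mono (letter s i * mono b).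
Proof.
case: b => m d; rewrite /mono /=.
have [w [wE w1]] := letter_zpow s i (d i).
pose d' : lattice n := d + (if s then unit_vec i else - unit_vec i).
have wq j k : j != i -> qcomm w (zpow j k).
  move=> ji; have h t : qcomm w (letter t j).
    have ij : i != j by rewrite eq_sym.
    case: w1 => ->; first exact/qcomm_sym/qcomm1.
    by apply/qcomm_sym/qcommM; apply/qcomm_letter.
  by apply: qcomm_zpow; [exact: (h true)|exact: (h false)].
apply: (@in_span_proportional _ _ _ _ _ (xmono m * w * zmono d')).
  apply: (@proportional_trans _ _ (xmono m * (letter s i * zmono d))).
    rewrite !mulrA; apply: proportionalMr; apply: qcomm_prod => k _.
    exact/qcommX/qcomm_sym/qcomm_tail_letter.
  rewrite -mulrA; apply: proportionalMl.
  apply: (@proportional_trans _ _ (\prod_j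
      (if j == i then letter s i * zpow j (d j) else zpow j (d j)))).
    apply: qcomm_into_finprod => j ji.
    by apply: qcomm_zpow; rewrite -?[z j]/(letter true j) -?[star (z j)]/(letter false j);
      apply: qcomm_letter; rewrite eq_sym.
  apply: proportional_sym.
  apply: proportional_trans (qcomm_into_finprod (i := i) _) _.
    by move=> j; exact: wq.
  rewrite (eq_bigr (fun j => if j == i then letter s i * zpow j (d j) else zpow j (d j))).
    exact: proportional_refl.
  move=> j _; rewrite /d' ffunE; case: eqVneq => [->|ji].
    by rewrite wE; case: (s); rewrite !ffunE eqxx.
  by case: (s); rewrite !ffunE (negPf ji) ?oppr0 addr0.
case: w1 => ->; first by rewrite mulr1; exact: (in_spanS mono (m, d')).
have [c ->] : exists c : R[i], letter s i * letter (~~ s) i = x i + c *: x i.+1.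
  case: (s) => /=; first by exists (-1); rewrite z_starz scaleN1r.
  by exists (- (q ^+ 2)%:C); rewrite starz_z scaleNr.
rewrite mulrDr mulrDl -scalerAr -scalerAl.
apply: in_spanD; first by apply: tail_xmono; rewrite ltnW.
by apply: in_spanZ; apply: tail_xmono.
Qed.

(** The span contains 1 and is stable under left multiplication by all
    generators and their adjoints. *)
Lemma mono_span (a : A) : in_span mono a.
Proof.
have mult (u : star_expr R[i] 'I_n.+1) : forall b, in_span mono b ->
    in_span mono (star_eval z u * b) /\ in_span mono (star (star_eval z u) * b).
  elim: u => /= [i|||u hu v hv|u hu|u hu v hv|c u hu|u hu] b hb.
  - by split; apply: in_spanM hb; [exact: (letter_mono true)|exact: (letter_mono false)].
  - by rewrite star0 mul0r; split; exact: in_span0.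
  - by rewrite star1 mul1r.
  - have [h h'] := hu b hb; have [k k'] := hv b hb.
    by rewrite starD !mulrDl; split; exact: in_spanD.
  - have [h h'] := hu b hb.
    by split; rewrite ?starN mulNr -scaleN1r; exact: in_spanZ.
  - rewrite starM -!mulrA; split.
      by have [h _] := hv b hb; have [] := hu _ h.
    by have [_ h] := hu b hb; have [] := hv _ h.
  - have [h h'] := hu b hb; rewrite starZ -!scalerAl.
    by split; exact: in_spanZ.
  - by rewrite starK; have [] := hu b hb.
have [u ->] := qsphere_exprP a.
have [|h _] := mult u 1; last by rewrite mulr1 in h.
have -> : 1 = mono ([ffun=> 0%N], 0).
  by rewrite /mono /xmono /zmono !big1 ?mulr1 // => i _; rewrite ffunE.
exact: in_spanS.
Qed.

End SphereSpan.

(** * Linear independence, and the theorem *)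

Section Eventually.
Variable n : nat.
Local Notation X := (lattice n).

(** The weight of a monomial can vanish near the boundary of the cone, so
    identities are only available at points whose coordinates are all large. *)
Definition ev (P : X -> Prop) := exists N : nat, forall y : X,
  (forall i, N%:Z <= y i) -> P y.

Lemma evT (P : X -> Prop) : (forall y, P y) -> ev P.
Proof. by move=> h; exists 0%N => y _; exact: h. Qed.

Lemma ev_and (P Q S : X -> Prop) : (forall y, P y -> Q y -> S y) ->
  ev P -> ev Q -> ev S.
Proof.
move=> h [N hN] [M hM]; exists (maxn N M) => y hy.
by apply: h; [apply: hN|apply: hM] => i; apply: le_trans (hy i);
  rewrite lez_nat ?leq_maxl ?leq_maxr.
Qed.

Lemma ev_shift (P : X -> Prop) k : ev P -> ev (fun y => P (y + k)).
Proof.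
move=> [N hN]; exists (N + \sum_i `|k i|)%N => y hy; apply: hN => i.
rewrite ffunE -lerBlDr; apply: le_trans (hy i); rewrite PoszD lerD2l.
apply: le_trans (lez_abs (- k i)) _; rewrite abszN.
by rewrite lez_nat (bigD1 i) //= leq_addr.
Qed.

Lemma ev_cone : ev (@cone n).
Proof. by exists 0%N => y hy i _; exact: hy. Qed.

Lemma ev_ex (P : X -> Prop) : ev P -> exists y, P y.
Proof. by move=> [N hN]; exists [ffun=> N%:Z]; apply: hN => i; rewrite ffunE. Qed.

(** Dedekind's argument: shifting the relation by k and subtracting chi_b0(k) times
    the relation itself eliminates the character chi_b0. Relations that hold
    only eventually suffice, as shifts preserve this property. *)
Lemma characters_independent (K : fieldType) (I : eqType) (s : seq I)
    (chi : I -> X -> K) (c : I -> K) :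
  uniq s ->
  (forall b y k, chi b (y + k) = chi b y * chi b k) ->
  (forall b y, chi b y != 0) ->
  {in s &, forall b b', b != b' -> exists k, chi b k != chi b' k} ->
  ev (fun y => \sum_(b <- s) c b * chi b y = 0) ->
  forall b, b \in s -> c b = 0.
Proof.
move=> + chiD chi0; elim: s c => // b0 s IH c /= /andP[b0s us] sep hc.
have cs b : b \in s -> c b = 0.
  move=> bs; have [|||k bk] := sep b b0; rewrite ?mem_head ?inE ?bs ?orbT //.
    by apply: contraNneq b0s => <-.
  suff : c b * (chi b k - chi b0 k) = 0.
    by move/eqP; rewrite mulf_eq0 subr_eq0 (negPf bk) orbF => /eqP.
  apply: (IH (fun b => c b * (chi b k - chi b0 k))) => //.
    by move=> u v us' vs'; apply: sep; rewrite inE ?us' ?vs' orbT.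
  apply: ev_and (ev_shift k hc) hc => y; rewrite !big_cons => h1 h2.
  transitivity ((c b0 * chi b0 (y + k) + \sum_(j <- s) c j * chi j (y + k)) -
    chi b0 k * (c b0 * chi b0 y + \sum_(j <- s) c j * chi j y)).
    rewrite chiD mulrDr opprD addrACA [chi b0 k * _]mulrC -mulrA subrr add0r.
    rewrite mulr_sumr -sumrB; apply: eq_bigr => j _; rewrite chiD; ring.
  by rewrite h1 h2 mulr0 subr0.
move=> b; rewrite inE => /predU1P[->|]; last exact: cs.
have [y] := ev_ex hc; rewrite big_cons big_seq big1 ?addr0 => [|j /cs->].
  by move/eqP; rewrite mulf_eq0 (negPf (chi0 _ _)) orbF => /eqP.
by rewrite mul0r.
Qed.

End Eventually.

Section Faithful.
Variables (R : realType) (n : nat) (q : R).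
Hypotheses (hq0 : 0 < q) (hq1 : q < 1).
Local Notation X := (lattice n).
Local Notation V := (hspace R n).
Local Notation e := unit_vec.
Variable f : qsphere n q -> adjointable V.
Hypothesis hf : star_hom f.
Hypothesis fz : forall i, f (qsphere_z q i) = zop hq0 i.
Local Notation z := (@qsphere_z R n q).

(** The pair (d, g) of a product is computed from those of its factors, and g can
    be read off from the action on basis vectors. *)
Definition has_symbol (T : adjointable V) (d : X) (g : X -> R[i]) :=
  forall (v : hvec R n) y, hfun (op_fun T v) y = g y * v (y - d).

Definition shiftlike T d :=
  exists g, has_symbol T d g /\ ev (fun y => g y != 0).

Lemma has_symbolM S T d d' g g' : has_symbol S d g -> has_symbol T d' g' ->
  has_symbol (S * T) (d + d') (fun y => g y * g' (y - d)).
Proof.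
move=> hS hT v y; rewrite -[LHS]/(hfun (op_fun S (op_fun T v)) y).
by rewrite hS hT mulrA opprD addrA.
Qed.

Lemma has_symbol1 : has_symbol 1 0 (fun=> 1).
Proof. by move=> v y; rewrite mul1r subr0. Qed.

Lemma has_symbol_ext T d d' g g' : has_symbol T d g -> d = d' -> g =1 g' ->
  has_symbol T d' g'.
Proof. by move=> h <- gg v y; rewrite h gg. Qed.

Lemma has_symbolM0 S T g g' : has_symbol S 0 g -> has_symbol T 0 g' ->
  has_symbol (S * T) 0 (fun y => g y * g' y).
Proof.
move=> hS hT; refine (has_symbol_ext (has_symbolM hS hT) (addr0 _) _) => y.
by rewrite subr0.
Qed.

Lemma has_symbolX0 T g k : has_symbol T 0 g ->
  has_symbol (T ^+ k) 0 (fun y => g y ^+ k).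
Proof.
move=> h; elim: k => [|k IH]; first exact: has_symbol1.
rewrite [T ^+ _]exprS; refine (has_symbol_ext (has_symbolM0 h IH) erefl _) => y.
by rewrite exprS.
Qed.

Lemma has_symbol_prod0 (I : Type) (r : seq I) F (G : I -> X -> R[i]) :
  (forall k, has_symbol (F k) 0 (G k)) ->
  has_symbol (\prod_(k <- r) F k) 0 (fun y => \prod_(k <- r) G k y).
Proof.
move=> h; elim: r => [|k r IH].
  rewrite big_nil; refine (has_symbol_ext has_symbol1 erefl _) => y.
  by rewrite big_nil.
rewrite big_cons; refine (has_symbol_ext (has_symbolM0 (h k) IH) erefl _) => y.
by rewrite big_cons.
Qed.

Lemma shiftlikeM S T d d' : shiftlike S d -> shiftlike T d' ->
  shiftlike (S * T) (d + d').
Proof.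
move=> [g [hS gS]] [g' [hT gT]]; exists (fun y => g y * g' (y - d)).
split; first exact: has_symbolM.
by apply: ev_and gS (ev_shift (- d) gT) => y; exact: mulf_neq0.
Qed.

Lemma shiftlike1 : shiftlike 1 0.
Proof.
exists (fun=> 1); split; first exact: has_symbol1.
by apply: evT => y; exact: oner_neq0.
Qed.

Lemma shiftlikeX T d k : shiftlike T d -> shiftlike (T ^+ k) (d *+ k).
Proof.
move=> h; elim: k => [|k IH]; first by rewrite expr0 mulr0n; exact: shiftlike1.
by rewrite exprS mulrS; exact: shiftlikeM.
Qed.

Lemma shiftlike_z i : shiftlike (f (z i)) (e i).
Proof.
rewrite fz; exists (fun y => (wt q i y)%:C); split; first by [].
exists 1%N => y hy; rewrite realC_eq0 gt_eqF // wt_gt0 // => [j _|_].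
  exact: le_trans (hy j).
exact: lt_le_trans (hy i).
Qed.

Lemma shiftlike_star_z i : shiftlike (f (star (z i))) (- e i).
Proof.
have -> : f (star (z i)) = star (zop hq0 i) by case: hf => _ _ _ _ ->; rewrite fz.
exists (fun y => (wt q i (y + e i))%:C); split.
  by move=> v y; rewrite star_zopE opprK.
exists 0%N => y hy; rewrite realC_eq0.
have ey j : 0 <= e i j by rewrite unit_vecE.
rewrite gt_eqF // wt_gt0 // => [j _|_]; first by rewrite ffunE addr_ge0.
by rewrite !ffunE eqxx ltr_wpDl.
Qed.

Lemma shiftlike_zpow i k : shiftlike (f (zpow q i k)) (e i *~ k).
Proof.
case: k => m; rewrite /zpow (star_homX hf).
  by rewrite -pmulrn; exact/shiftlikeX/shiftlike_z.
by rewrite NegzE mulrNz -pmulrn -mulNrn; exact/shiftlikeX/shiftlike_star_z.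
Qed.

Lemma shiftlike_zmono d : shiftlike (f (zmono q d)) d.
Proof.
have {2}-> : d = \sum_(i < n.+1) e i *~ d i.
  apply/ffunP => j; rewrite sum_ffunE (bigD1 j) //= big1 => [|i ij].
    by rewrite ffunMzE unit_vecE eqxx addr0 intz.
  by rewrite ffunMzE unit_vecE eq_sym (negPf ij) mul0rz.
rewrite /zmono (star_hom_prod hf).
elim/big_rec2: _ => [|i T T' _ h]; first exact: shiftlike1.
by apply: shiftlikeM => //; exact: shiftlike_zpow.
Qed.

Definition chi (m : {ffun 'I_n -> nat}) (y : X) : R[i] :=
  \prod_(k < n) (tau q k.+1 y)%:C ^+ m k.

Lemma symbol_tail k : (k <= n.+1)%N -> has_symbol (f (zz_tail n q k)) 0
  (fun y => (tau q k y)%:C).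
Proof.
move=> kn v y; rewrite subr0 -tail_zop // /zz_tail (star_hom_sum hf).
congr (hfun (@op_fun R V _ v) y); apply: eq_bigr => j _.
by case: hf => _ _ _ -> ->; rewrite fz.
Qed.

Lemma symbol_xmono m : has_symbol (f (xmono q m)) 0 (chi m).
Proof.
rewrite /xmono (star_hom_prod hf); apply: has_symbol_prod0 => k.
by rewrite (star_homX hf); apply: has_symbolX0; apply: symbol_tail; exact: (ltnW (ltn_ord k)).
Qed.

Lemma chiD m y y' : chi m (y + y') = chi m y * chi m y'.
Proof.
rewrite /chi -big_split; apply: eq_bigr => k _.
by rewrite tauD // rmorphM exprMn.
Qed.

Lemma chi_neq0 m y : chi m y != 0.
Proof.
apply/prodf_neq0 => k _; rewrite expf_neq0 // realC_eq0 gt_eqF //.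
by rewrite tau_gt0.
Qed.

(** At u = e_j - e_(j+1) all tau_(k+1) take the value 1 except tau_(j+1), which is
    q^2; so chi_m(u) = q^(2 m_j). *)
Lemma chi_separates m m' : m != m' -> exists y, chi m y != chi m' y.
Proof.
move=> mm; have [j mj] : exists j, m j != m' j.
  apply: contrapT => h; move/eqP: mm; apply; apply/ffunP => j.
  by apply: contrapT => /eqP mj; apply: h; exists j.
pose i1 : 'I_n.+1 := widen_ord (leqnSn n) j.
pose i2 : 'I_n.+1 := lift ord0 j.
pose u : X := e i1 - e i2.
have tau_u (k : 'I_n) : tau q k.+1 u = if k == j then q ^+ 2 else 1.
  have t0 : tau q k.+1 (0 : X) = 1.
    rewrite /tau ltn_ord big1 ?expr0z // => i _; exact: ffunE.
  have := tau_shift hq0 k.+1 u i2; rewrite subrK -[e i1]add0r tau_shift // t0.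
  rewrite /= /bump /= add1n !ltnS mulr1.
  have q2 : q ^+ 2 != 0 by rewrite expf_neq0 // gt_eqF.
  rewrite -val_eqE; case: (ltngtP j k) => _ /=.
  - by move=> h; apply: (mulfI q2); rewrite mulr1.
  - by rewrite mul1r.
  - by rewrite mul1r.
have chi_u p : chi p u = (q ^+ 2)%:C ^+ p j.
  rewrite /chi (bigD1 j) //= big1 ?mulr1 ?tau_u ?eqxx // => k kj.
  by rewrite tau_u (negPf kj) rmorph1 expr1n.
exists u; rewrite !chi_u -!rmorphXn (inj_eq (@complexI R)).
rewrite (inj_eq (ieexprIn _ _)) // ?exprn_gt0 // lt_eqF //.
by rewrite expr_lt1 // ltW.
Qed.

(** Applying the relation to the basis vector at y - d and evaluating at y singles
    out the monomials that shift by d. Their weights share the factor g_d(y),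
    nonzero for large y, and differ by the characters only. *)
Lemma mono_independent (s : seq ({ffun 'I_n -> nat} * X)) (c : _ -> R[i]) :
  uniq s -> f (\sum_(b <- s) c b *: mono q b) = 0 ->
  forall b, b \in s -> c b = 0.
Proof.
move=> us fa b0 b0s.
have /choice[g hg] : forall d, exists g, has_symbol (f (zmono q d)) d g /\
    ev (fun y => g y != 0) by exact: shiftlike_zmono.
pose t := [seq b <- s | b.2 == b0.2].
apply: (@characters_independent n R[i] _ t (fun b => chi b.1) c).
- exact: filter_uniq.
- by move=> b y k; exact: chiD.
- by move=> b y; exact: chi_neq0.
- move=> b b'; rewrite !mem_filter => /andP[/eqP b2 _] /andP[/eqP b'2 _] bb.
  apply: chi_separates; apply: contra_neq bb => b1.
  by case: b b' b2 b'2 b1 => [? ?] [? ?] /= -> -> ->.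
- have [_ gd] := hg b0.2.
  apply: ev_and gd (ev_shift (- b0.2) (ev_cone n)) => y gy cy.
  have fE : f (\sum_(b <- s) c b *: mono q b) =
      \sum_(b <- s) c b *: (f (xmono q b.1) * f (zmono q b.2)).
    rewrite (star_hom_sum hf); apply: eq_bigr => b _.
    by case: hf => _ fZ _ fM _; rewrite fZ fM.
  have := congr1 (fun T : adjointable V => hfun (op_fun T (hdelta R cy)) y) fa.
  rewrite fE op_sumE hvec_sumE [RHS]/= => sum0.
  apply: (mulIf gy); rewrite mul0r -[RHS]sum0 big_filter big_mkcond mulr_suml.
  apply: eq_bigr => b _.
  rewrite -[RHS]/(c b * hfun (op_fun (f (xmono q b.1) * f (zmono q b.2)) (hdelta R cy)) y).
  have [h _] := hg b.2; rewrite (has_symbolM (symbol_xmono b.1) h) add0r subr0.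
  rewrite /= (inj_eq (addrI _)) (inj_eq oppr_inj).
  by case: eqVneq => [->|_]; rewrite ?mulr1 ?mulr0 ?mul0r ?mulrA.
- by rewrite mem_filter eqxx.
Qed.

Lemma sphere_rep_faithful a : f a = 0 -> a = 0.
Proof.
have [s [c [us ->]]] := in_span_uniq (mono_span (lt0r_neq0 hq0) a) => fa.
by rewrite big_seq big1 // => b bs; rewrite (mono_independent us fa bs) scale0r.
Qed.

End Faithful.

Lemma qsphere_separating (R : realType) (n : nat) (q : R) : 0 < q -> q < 1 ->
  exists p : cstar_seminorm (qsphere n q), forall a, p a = 0 -> a = 0.
Proof.
move=> q0 q1; have [f [hf fz]] := sphere_rep n q0 q1.
exists (rep_csn hf (sphere_rep_bounded hf)) => a /rep_csn_eq0.
exact: (sphere_rep_faithful q1 hf fz).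
Qed.

Theorem proposition3p13 (R : realType) (n : nat) (q : R)
    (hq0 : 0 <= q) (hq1 : q < 1) :
  (exists (B : cstarAlgType R) (phi : qsphere n q -> B),
      universal_cstar phi) /\
  (q != 0 ->
    forall (B : cstarAlgType R) (phi : qsphere n q -> B),
      universal_cstar phi -> injective phi).
Proof.
split; first exact: qsphere_universal_exists.
move=> q0 B phi [hphi univ] a b phi_ab.
have q_gt0 : 0 < q by rewrite lt_neqAle eq_sym q0.
have [p hp] := qsphere_separating n q_gt0 hq1.
have [g [[_ gphi] _]] := univ (completion p) _ (cplt_const_hom p).
apply/subr0_eq/hp; rewrite -cplt_norm_const.
have -> : cplt_const p (a - b) = 0.
  rewrite (star_homB (cplt_const_hom p)) -!gphi phi_ab.
  exact: subrr.
exact: (csn0 (cplt_csn p)).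
Qed.
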